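(* Let $A{_\tau\times_\sigma}B$ be a smash biproduct bialgebra such that $\sigma$ is right conormal and $\tau$ is left normal. Then $A{_\tau\times_\sigma}B$ admits a quasitriangular structure if and only if there exist normalized elements $W=\sum W^1\otimes W^2\in B\otimes B$, $X=\sum X^1\otimes X^2\in A\otimes B$, $Y=\sum Y^1\otimes Y^2\in B\otimes A$ and $Z=\sum Z^1\otimes Z^2\in A\otimes A$ satisfying the following identities C1'')–C19'') for all $a\in A$, $b\in B$: C1'') $\sum Z^1\bar X^1X^1a_{(1)\sigma_2}\,\epsilon_B((W^1Y^1)_{\sigma_2})\otimes Z^2Y^2_{\sigma_1}\,\epsilon_B(\bar X^2_{\sigma_1})\,a_{(2)\sigma_3}\,\epsilon_B((X^2W^2)_{\sigma_3})=\sum a_{(2)}Z^1\otimes a_{(1)}Z^2$; C2'') $\sum X^1a_\sigma\,\epsilon_B(W^1_\sigma)\otimes X^2W^2=\sum aX^1\otimes X^2$; C3'') $\sum W^1Y^1\otimes Y^2a_\sigma\,\epsilon_B(W^2_\sigma)=\sum Y^1\otimes aY^2$; C4'') $\sum Z^1\otimes Z^2\epsilon_B(b)=\sum 1_{A\tau}Z^1_{\sigma_1}\,\epsilon_B(b_{(2)\sigma_1})\otimes Z^2_{\sigma_2}\,\epsilon_B(b_{(1)\tau\sigma_2})$; C5'') $\sum X^1\otimes X^2b=\sum 1_{A\tau}X^1_\sigma\,\epsilon_B(b_{(2)\sigma})\otimes b_{(1)\tau}X^2$; C6'') $\sum W^1Y^1b_\tau\otimes Y^21_{A\tau\sigma}\,\epsilon_B(W^2_\sigma)=\sum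 b_\sigma Y^1\otimes Y^2_\sigma$; C7'') $\sum W^1b_{(1)}\otimes W^2b_{(2)}=\sum b_{(2)}W^1\otimes b_{(1)}W^2$; C8'') $\sum Z^1_{(1)}\otimes Z^1_{(2)}\otimes Z^2=\sum Z^1X^1\otimes\bar Z^1\otimes Z^2\bar Z^2_\sigma\,\epsilon_B(X^2_\sigma)$; C9'') $\sum X^1_{(1)}\otimes X^1_{(2)}\otimes X^2=\sum X^1\otimes\bar X^1\otimes X^2\bar X^2$; C10'') $\sum Y^1_\tau\otimes(Z^1X^1)_\tau\otimes Z^2Y^2_\sigma\,\epsilon_B(X^2_\sigma)=\sum W^1Y^1\otimes Z^1\otimes Y^2Z^2_\sigma\,\epsilon_B(W^2_\sigma)$; C11'') $\sum W^1_\tau\otimes X^1_\tau\otimes X^2W^2=\sum W^1\otimes X^1\otimes W^2X^2$; C12'') $\sum Y^1_{(1)}\otimes Y^1_{(2)}\otimes Y^2=\sum W^1Y^1\otimes\bar Y^1\otimes Y^2\bar Y^2_\sigma\,\epsilon_B(W^2_\sigma)$; C13'') $\sum W^1_{(1)}\otimes W^1_{(2)}\otimes W^2=\sum W^1\otimes\bar W^1\otimes W^2\bar W^2$; C14'') $\sum Z^1\otimes Z^2_{(1)}\otimes Z^2_{(2)}=\sum Z^1X^1\bar Z^1_{\sigma_1}\,\epsilon_B(Y^1_{\sigma_1})\otimes\bar Z^2\otimes Z^2Y^2_{\sigma_2}\,\epsilon_B(X^2_{\sigma_2})$; C15'') $\sum Z^1X^1\otimes X^2_\tau\otimes Z^2_\tau=\sum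 Z^1X^1\bar X^1_{\sigma_1}\,\epsilon_B(Y^1_{\sigma_1})\otimes\bar X^2\otimes Z^2Y^2_{\sigma_2}\,\epsilon_B(X^2_{\sigma_2})$; C16'') $\sum X^1\otimes X^2_{(1)}\otimes X^2_{(2)}=\sum X^1\bar X^1\otimes X^2\otimes\bar X^2$; C17'') $\sum Y^1\otimes Y^2_{(1)}\otimes Y^2_{(2)}=\sum Y^1\bar Y^1\otimes\bar Y^2\otimes Y^2$; C18'') $\sum W^1Y^1\otimes W^2_\tau\otimes Y^2_\tau=\sum Y^1W^1\otimes W^2\otimes Y^2$; C19'') $\sum W^1\otimes W^2_{(1)}\otimes W^2_{(2)}=\sum W^1\bar W^1\otimes\bar W^2\otimes W^2$. In this case, the quasitriangular structure is given as $$\alpha=\sum Z^1\bar X^1X^1\otimes W^1Y^1\otimes Z^2Y^2_\sigma\,\epsilon_B(\bar X^2_\sigma)\otimes X^2W^2\in(A\otimes B)\otimes(A\otimes B).$$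
   Context: Everything is over a field $\Bbbk$. Algebras are associative and unital, coalgebras coassociative and counital; $\Delta(c)=\sum c_{(1)}\otimes c_{(2)}$. Smash product: for algebras $A,B$ and a linear map $\sigma:B\otimes A\to A\otimes B$, written $\sigma(b\otimes a)=\sum a_\sigma\otimes b_\sigma$, consider on $A\otimes B$ the multiplication $(a\otimes b)(a'\otimes b')=\sum aa'_\sigma\otimes b_\sigma b'$. If it is associative with unit $1_A\otimes 1_B$, this algebra is the smash product $A\#_\sigma B$. Smash coproduct: for coalgebras $A,B$ and a linear map $\tau:A\otimes B\to B\otimes A$, written $\tau(a\otimes b)=\sum b_\tau\otimes a_\tau$, consider on $A\otimes B$ the comultiplication $a\otimes b\mapsto\sum a_{(1)}\otimes b_{(1)\tau}\otimes a_{(2)\tau}\otimes b_{(2)}$. If it is coassociative with counit $\epsilon_A\otimes\epsilon_B$, this coalgebra is the smash coproduct $A{_\tau\ltimes}B$. Smash biproduct: if $A,B$ are both algebras and coalgebras (neither necessarily a bialgebra), $A\#_\sigma B$ is a smash product, $A{_\tau\ltimes}B$ is a smash coproduct, and $A\otimes B$ with these two structures is a bialgebra, this bialgebra is denoted $A{_\tau\times_\sigma}B$ and called a smash biproduct bialgebra. Standing assumption: for every smash biproduct bialgebra, $A$ and $B$ are counital algebras via $\epsilon_A,\epsilon_B$ (i.e. $\epsilon_A,\epsilon_B$ are algebra maps to $\Bbbk$) and unital coalgebras via $\eta_A,\eta_B$ (i.e. the unit maps $\Bbbk\to A$, $\Bbbk\to B$ are coalgebra maps). $\sigma$ is right conormal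 if $\sum\epsilon_A(a_\sigma)b_\sigma=\epsilon_A(a)b$ for all $a\in A,b\in B$. $\tau$ is left normal if $\tau(a\otimes 1_B)=\sum 1_{B\tau}\otimes a_\tau=1_B\otimes a$ for all $a\in A$. A quasitriangular structure of a bialgebra $H$ is an element $\mathcal R=\sum\mathcal R^1\otimes\mathcal R^2\in H\otimes H$ (not required invertible) with: (QT1) $(\epsilon_H\otimes id)(\mathcal R)=1_H=(id\otimes\epsilon_H)(\mathcal R)$; (QT2) $(\Delta_H\otimes id)(\mathcal R)=\mathcal R_{13}\mathcal R_{23}$; (QT3) $(id\otimes\Delta_H)(\mathcal R)=\mathcal R_{13}\mathcal R_{12}$; (QT4) $\mathcal R\Delta_H(h)=\Delta_H^{cop}(h)\mathcal R$ for all $h\in H$. For $H=A{_\tau\times_\sigma}B$, $H\otimes H=A\otimes B\otimes A\otimes B$. Normalized elements: $W\in B\otimes B$ is normalized if $\sum\epsilon_B(W^1)W^2=1_B=\sum W^1\epsilon_B(W^2)$; $X\in A\otimes B$ if $\sum\epsilon_A(X^1)X^2=1_B$ and $\sum X^1\epsilon_B(X^2)=1_A$; $Y\in B\otimes A$ if $\sum\epsilon_B(Y^1)Y^2=1_A$ and $\sum Y^1\epsilon_A(Y^2)=1_B$; $Z\in A\otimes A$ if $\sum\epsilon_A(Z^1)Z^2=1_A=\sum Z^1\epsilon_A(Z^2)$. Index notation: $\sigma_i$ (resp. $\tau_i$) is a copy of $\sigma$ (resp. $\tau$). If an index $\sigma_i$ appears on an element coming from $B$ and on an element coming from $A$, then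 $\sigma_i$ has been applied to ($B$-element)$\otimes$($A$-element); similarly $\tau_i$ is applied to ($A$-element)$\otimes$($B$-element). Several subscripts on one element are applied successively from left to right (including comultiplication subscripts $(1),(2)$); an index on a bracketed product applies to the product. Decorated letters such as $\bar X=\sum\bar X^1\otimes\bar X^2$ denote further copies of the same element $X$ (likewise for $W,Y,Z$). For example, in $\alpha$, $\sigma$ is applied to $\bar X^2\otimes Y^2$; in C4''), $\tau$ is applied to $1_A\otimes b_{(1)}$, then $\sigma_2$ to $b_{(1)\tau}\otimes Z^2$, and $\sigma_1$ to $b_{(2)}\otimes Z^1$. *)

(* Defs.v *)
From HB Require Import structures.
From mathcomp Require Import all_boot all_algebra.
From mathcomp Require Import boolp.
Set Implicit Arguments.
Unset Strict Implicit.
Unset Printing Implicit Defensive.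
Import GRing.Theory.
Local Open Scope ring_scope.
Local Open Scope quotient_scope.

Reserved Notation "x ⊗ y" (at level 38, left associativity).

(* The tensor product of two vector spaces: finite formal sums of pairs (u, v)
   modulo the congruence generated by the bilinearity relations.  Opposites and
   scalars are absorbed by the first component of the pairs. *)
Section Tensor.
Variables (k : fieldType) (U V : lmodType k).

Inductive tens_rel : seq (U * V) -> seq (U * V) -> Prop :=
| tens_rel_refl s : tens_rel s s
| tens_rel_sym s t : tens_rel s t -> tens_rel t s
| tens_rel_trans s t r : tens_rel s t -> tens_rel t r -> tens_rel s r
| tens_rel_cat s s' t t' :
    tens_rel s s' -> tens_rel t t' -> tens_rel (s ++ t) (s' ++ t')
| tens_rel_catC s t : tens_rel (s ++ t) (t ++ s)
| tens_rel_addl u u' v : tens_rel [:: (u + u', v)] [:: (u, v); (u', v)]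
| tens_rel_addr u v v' : tens_rel [:: (u, v + v')] [:: (u, v); (u, v')]
| tens_rel_scale c u v : tens_rel [:: (c *: u, v)] [:: (u, c *: v)]
| tens_rel_0 v : tens_rel [:: (0, v)] [::].

Definition tens_relb (s t : seq (U * V)) : bool := `[< tens_rel s t >].

Lemma tens_relb_refl : reflexive tens_relb.
Proof. by move=> s; apply/asboolP/tens_rel_refl. Qed.
Lemma tens_relb_sym : symmetric tens_relb.
Proof. by move=> s t; apply/asboolP/asboolP; apply: tens_rel_sym. Qed.
Lemma tens_relb_trans : transitive tens_relb.
Proof.
move=> t s r /asboolP st /asboolP tr; apply/asboolP.
exact: tens_rel_trans st tr.
Qed.

Canonical tens_equiv :=
  EquivRel tens_relb tens_relb_refl tens_relb_sym tens_relb_trans.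

Definition tensor : Type := {eq_quot tens_equiv}.
HB.instance Definition _ := Choice.on tensor.

Definition tclass (s : seq (U * V)) : tensor :=
  \pi_({eq_quot tens_equiv}) s.

Definition tens (u : U) (v : V) : tensor := tclass [:: (u, v)].

(* A representative of t: a chosen list of pairs (t^1, t^2) with
   t = \sum t^1 ⊗ t^2.  The sum \sum_(p <- terms t) f p.1 p.2 then renders
   "\sum f(t^1, t^2)"; when f is bilinear, sum_terms_class and sum_terms_tens
   show that it does not depend on the representative. *)
Definition terms (t : tensor) : seq (U * V) :=
  repr (t : {eq_quot tens_equiv}).

Lemma termsK t : tclass (terms t) = t.
Proof. exact: reprK. Qed.

Lemma tclassP s t : tclass s = tclass t <-> tens_rel s t.
Proof.
split=> [/eqP|st]; first by rewrite /tclass eqmodE => /asboolP.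
by apply/eqP; rewrite /tclass eqmodE; apply/asboolP.
Qed.

Lemma terms_class s : tens_rel (terms (tclass s)) s.
Proof. by apply/tclassP; rewrite termsK. Qed.

Definition tadd (x y : tensor) := tclass (terms x ++ terms y).
Definition tscale (c : k) (x : tensor) :=
  tclass [seq (c *: p.1, p.2) | p <- terms x].
Definition topp (x : tensor) := tscale (-1) x.
Definition tzero := tclass [::].

Let scl c (s : seq (U * V)) := [seq (c *: p.1, p.2) | p <- s].

Lemma tens_rel_scl c s t : tens_rel s t -> tens_rel (scl c s) (scl c t).
Proof.
elim=> {s t}.
- by move=> s; apply: tens_rel_refl.
- by move=> s t _; apply: tens_rel_sym.
- by move=> s t r _ st _; apply: tens_rel_trans st.
- by move=> s s' t t' _ ss _ tt; rewrite /scl !map_cat; apply: tens_rel_cat.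
- by move=> s t; rewrite /scl !map_cat; apply: tens_rel_catC.
- by move=> u u' v; rewrite /= scalerDr; apply: tens_rel_addl.
- by move=> u v v'; apply: tens_rel_addr.
- by move=> d u v; rewrite /= scalerA mulrC -scalerA; apply: tens_rel_scale.
- by move=> v; rewrite /= scaler0; apply: tens_rel_0.
Qed.

Lemma taddE s t : tadd (tclass s) (tclass t) = tclass (s ++ t).
Proof. by apply/tclassP; apply: tens_rel_cat; apply: terms_class. Qed.

Lemma tscaleE c s : tscale c (tclass s) = tclass (scl c s).
Proof. by apply/tclassP/tens_rel_scl/terms_class. Qed.

Lemma taddA : associative tadd.
Proof.
move=> x y z; rewrite -[x]termsK -[y]termsK -[z]termsK.
by rewrite !taddE catA.
Qed.

Lemma taddC : commutative tadd.
Proof. by move=> x y; apply/tclassP/tens_rel_catC. Qed.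

Lemma tadd0 : left_id tzero tadd.
Proof. by move=> x; rewrite -[x]termsK taddE. Qed.

Lemma taddACA x y z t : tadd (tadd x y) (tadd z t) = tadd (tadd x z) (tadd y t).
Proof. by rewrite -!taddA (taddA y z) (taddC y z) -taddA. Qed.

Lemma tscaleDr c : {morph tscale c : x y / tadd x y}.
Proof.
move=> x y; rewrite -[x]termsK -[y]termsK taddE !tscaleE taddE.
by rewrite /scl map_cat.
Qed.

Lemma tscaleDl x a b : tscale (a + b) x = tadd (tscale a x) (tscale b x).
Proof.
rewrite -[x]termsK !tscaleE; elim: (terms x) => [|[u v] s IHs] /=.
  by rewrite taddE.
have tclass_cons p r : tclass (p :: r) = tadd (tclass [:: p]) (tclass r).
  by rewrite taddE.
rewrite tclass_cons [in RHS]tclass_cons [tclass (_ :: scl b s)]tclass_cons IHs.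
rewrite taddACA; congr (tadd _ _); rewrite scalerDl taddE.
exact/tclassP/tens_rel_addl.
Qed.

Lemma tscale0 x : tscale 0 x = tzero.
Proof.
rewrite -[x]termsK tscaleE; elim: (terms x) => [//|[u v] s IHs] /=.
rewrite -cat1s -taddE IHs scale0r taddE cats0.
exact/tclassP/tens_rel_0.
Qed.

Lemma tscale1 x : tscale 1 x = x.
Proof.
rewrite -[x]termsK tscaleE; congr tclass; elim: (terms x) => //= -[u v] s ->.
by rewrite scale1r.
Qed.

Lemma tscaleA a b x : tscale a (tscale b x) = tscale (a * b) x.
Proof.
rewrite -[x]termsK !tscaleE /scl -map_comp; congr tclass.
by apply: eq_map => p /=; rewrite scalerA.
Qed.

Lemma taddN : left_inverse tzero topp tadd.
Proof.
by move=> x; rewrite -[X in tadd _ X]tscale1 -tscaleDl addNr tscale0.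
Qed.

HB.instance Definition _ :=
  GRing.isZmodule.Build tensor taddA taddC tadd0 taddN.
HB.instance Definition _ := GRing.Zmodule_isLmodule.Build k tensor
  tscaleA tscale1 tscaleDr tscaleDl.

End Tensor.

Notation "U ⊗ V" := (tensor U%type V%type) : type_scope.
Notation "u ⊗ v" := (tens u v) : ring_scope.

Section TensorTheory.
Variables (k : fieldType) (U V : lmodType k).
Implicit Types (t : U ⊗ V) (u : U) (v : V).

Lemma tclassD (s r : seq (U * V)) : tclass s + tclass r = tclass (s ++ r).
Proof. exact: taddE. Qed.

Lemma tclassZ c (s : seq (U * V)) :
  c *: tclass s = tclass [seq (c *: p.1, p.2) | p <- s].
Proof. exact: tscaleE. Qed.

Lemma tens_linearl v : linear (fun u => u ⊗ v).
Proof.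
move=> c u u'; rewrite /tens tclassZ tclassD; apply/tclassP/tens_rel_addl.
Qed.

Lemma tens_linearr u : linear (fun v => u ⊗ v).
Proof.
move=> c v v'; rewrite /tens tclassZ tclassD; apply/tclassP.
apply: tens_rel_trans (tens_rel_addr _ _ _) _.
rewrite -cat1s -[X in tens_rel _ X]cat1s; apply: tens_rel_cat => /=.
  exact/tens_rel_sym/tens_rel_scale.
exact: tens_rel_refl.
Qed.

Lemma tclass_sum (s : seq (U * V)) : tclass s = \sum_(p <- s) p.1 ⊗ p.2.
Proof.
elim: s => [|[u v] s IHs]; first by rewrite big_nil.
by rewrite big_cons -IHs tclassD.
Qed.

Lemma tensor_sum t : t = \sum_(p <- terms t) p.1 ⊗ p.2.
Proof. by rewrite -tclass_sum termsK. Qed.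

Section Lift.
Variables (W : lmodType k) (f : U -> V -> W).
Hypotheses (fl : forall v, linear (f^~ v)) (fr : forall u, linear (f u)).

Lemma tens_rel_sum (s t : seq (U * V)) :
  tens_rel s t -> \sum_(p <- s) f p.1 p.2 = \sum_(p <- t) f p.1 p.2.
Proof.
have f0 v : f 0 v = 0.
  by have := fl v (-1) 0 0; rewrite scaleN1r oppr0 addr0 scaleN1r addNr.
elim=> {s t} //.
- by move=> s t r _ -> _ ->.
- by move=> s s' t t' _ ss _ tt; rewrite !big_cat /= ss tt.
- by move=> s t; rewrite !big_cat /= addrC.
- move=> u u' v; rewrite !big_cons !big_nil /= !addr0.
  by have := fl v 1 u u'; rewrite !scale1r.
- move=> u v v'; rewrite !big_cons !big_nil /= !addr0.
  by have := fr u 1 v v'; rewrite !scale1r.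
- move=> c u v; rewrite !big_cons !big_nil /= !addr0.
  have := fr u c v 0; rewrite addr0 => ->; have := fl v c u 0.
  rewrite addr0 f0 addr0 => ->.
  by have := fr u (-1) 0 0; rewrite scaleN1r oppr0 addr0 scaleN1r addNr => ->; rewrite addr0.
- by move=> v; rewrite !big_cons !big_nil /= f0 addr0.
Qed.

Lemma sum_terms_class s :
  \sum_(p <- terms (tclass s)) f p.1 p.2 = \sum_(p <- s) f p.1 p.2.
Proof. exact/tens_rel_sum/terms_class. Qed.

Lemma sum_terms_tens u v : \sum_(p <- terms (u ⊗ v)) f p.1 p.2 = f u v.
Proof. by rewrite sum_terms_class big_seq1. Qed.

Lemma sum_terms_linear :
  linear (fun t => \sum_(p <- terms t) f p.1 p.2).
Proof.
move=> c s t.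
rewrite -[t in LHS]termsK -[s in LHS]termsK tclassZ tclassD sum_terms_class.
rewrite big_cat big_map scaler_sumr /=; congr (_ + _).
apply: eq_bigr => p _; have := fl p.2 c p.1 0.
rewrite addr0 => ->.
by have := fl p.2 (-1) 0 0; rewrite scaleN1r oppr0 addr0 scaleN1r addNr => ->; rewrite addr0.
Qed.

End Lift.
End TensorTheory.

Section Structures.
Variable k : fieldType.
Implicit Types V : lmodType k.

Record is_algebra V (m : V -> V -> V) (e : V) : Prop := IsAlgebra {
  alg_linearl : forall y, linear (m^~ y);
  alg_linearr : forall x, linear (m x);
  alg_assoc : associative m;
  alg_unitl : left_id e m;
  alg_unitr : right_id e m
}.

Record is_coalgebra V (D : V -> V ⊗ V) (eps : V -> k) : Prop := IsCoalgebra {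
  coalg_linear : linear D;
  coalg_scalar : scalar eps;
  coalg_coassoc : forall c : V,
    \sum_(p <- terms (D c)) \sum_(q <- terms (D p.1)) q.1 ⊗ (q.2 ⊗ p.2) =
    \sum_(p <- terms (D c)) \sum_(q <- terms (D p.2)) p.1 ⊗ (q.1 ⊗ q.2);
  coalg_counitl : forall c : V, \sum_(p <- terms (D c)) eps p.1 *: p.2 = c;
  coalg_counitr : forall c : V, \sum_(p <- terms (D c)) eps p.2 *: p.1 = c
}.

Definition tmul (U V : lmodType k) (mU : U -> U -> U) (mV : V -> V -> V)
    (x y : U ⊗ V) : U ⊗ V :=
  \sum_(p <- terms x) \sum_(q <- terms y) mU p.1 q.1 ⊗ mV p.2 q.2.

Definition tswap (U V : lmodType k) (x : U ⊗ V) : V ⊗ U :=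
  \sum_(p <- terms x) p.2 ⊗ p.1.

Record is_bialgebra V (m : V -> V -> V) (e : V)
    (D : V -> V ⊗ V) (eps : V -> k) : Prop := IsBialgebra {
  bialg_alg : is_algebra m e;
  bialg_coalg : is_coalgebra D eps;
  bialg_comulM : forall x y, D (m x y) = tmul m m (D x) (D y);
  bialg_comul1 : D e = e ⊗ e;
  bialg_counitM : forall x y, eps (m x y) = eps x * eps y;
  bialg_counit1 : eps e = 1
}.

Section Quasitriangular.
Variables (V : lmodType k) (m : V -> V -> V) (e : V).
Variables (D : V -> V ⊗ V) (eps : V -> k).

Definition leg12 (R : V ⊗ V) : V ⊗ (V ⊗ V) :=
  \sum_(r <- terms R) r.1 ⊗ (r.2 ⊗ e).
Definition leg13 (R : V ⊗ V) : V ⊗ (V ⊗ V) :=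
  \sum_(r <- terms R) r.1 ⊗ (e ⊗ r.2).
Definition leg23 (R : V ⊗ V) : V ⊗ (V ⊗ V) :=
  \sum_(r <- terms R) e ⊗ (r.1 ⊗ r.2).

Definition mul3 : V ⊗ (V ⊗ V) -> V ⊗ (V ⊗ V) -> V ⊗ (V ⊗ V) :=
  tmul m (tmul m m).

Record quasitriangular (R : V ⊗ V) : Prop := Quasitriangular {
  qt_counitl : \sum_(r <- terms R) eps r.1 *: r.2 = e;
  qt_counitr : \sum_(r <- terms R) eps r.2 *: r.1 = e;
  qt_comull :
    \sum_(r <- terms R) \sum_(d <- terms (D r.1)) d.1 ⊗ (d.2 ⊗ r.2) =
    mul3 (leg13 R) (leg23 R);
  qt_comulr :
    \sum_(r <- terms R) \sum_(d <- terms (D r.2)) r.1 ⊗ (d.1 ⊗ d.2) =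
    mul3 (leg13 R) (leg12 R);
  qt_comul : forall h : V,
    tmul m m R (D h) = tmul m m (tswap (D h)) R
}.

End Quasitriangular.
End Structures.

HB.mixin Record Lmodule_isCoalgebra (k : fieldType) V of GRing.Lmodule k V := {
  comul : V -> V ⊗ V;
  counit : V -> k;
  comul_coalgebra : is_coalgebra comul counit
}.

#[short(type="coalgType")]
HB.structure Definition Coalgebra (k : fieldType) :=
  {V of Lmodule_isCoalgebra k V & GRing.Lmodule k V}.

(* An algebra and a coalgebra on the same space, with no compatibility. *)
#[short(type="algCoalgType")]
HB.structure Definition AlgCoalgebra (k : fieldType) :=
  {V of Lmodule_isCoalgebra k V & GRing.Algebra k V}.

Definition counital_algebra (k : fieldType) (A : algCoalgType k) : Prop :=
  (forall a a' : A, counit (a * a') = counit a * counit a') /\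
  counit (1 : A) = 1.

Definition unital_coalgebra (k : fieldType) (A : algCoalgType k) : Prop :=
  comul (1 : A) = 1 ⊗ 1 /\ counit (1 : A) = 1.

Definition normalized (k : fieldType) (U V : algCoalgType k) (T : U ⊗ V) :
    Prop :=
  \sum_(t <- terms T) counit t.1 *: t.2 = 1 /\
  \sum_(t <- terms T) counit t.2 *: t.1 = 1.

Section SmashBiproduct.
Variables (k : fieldType) (A B : algCoalgType k).
Variables (sigma : {linear (B ⊗ A)%type -> (A ⊗ B)%type}).
Variables (tau : {linear (A ⊗ B)%type -> (B ⊗ A)%type}).

Definition smash_mul (x y : A ⊗ B) : A ⊗ B :=
  \sum_(p <- terms x) \sum_(q <- terms y)
    \sum_(s <- terms (sigma (p.2 ⊗ q.1))) (p.1 * s.1) ⊗ (s.2 * q.2).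

Definition smash_one : A ⊗ B := 1 ⊗ 1.

Definition smash_comul (x : A ⊗ B) : (A ⊗ B) ⊗ (A ⊗ B) :=
  \sum_(p <- terms x)
    \sum_(c <- terms (comul p.1)) \sum_(d <- terms (comul p.2))
      \sum_(t <- terms (tau (c.2 ⊗ d.1))) (c.1 ⊗ t.1) ⊗ (t.2 ⊗ d.2).

Definition smash_counit (x : A ⊗ B) : k :=
  \sum_(p <- terms x) counit p.1 * counit p.2.

(* Being a bialgebra includes that smash_mul, smash_one form an algebra (the
   smash product) and smash_comul, smash_counit a coalgebra (the smash
   coproduct). *)
Definition smash_biproduct_bialgebra : Prop :=
  is_bialgebra smash_mul smash_one smash_comul smash_counit.

Definition smash_quasitriangular (R : (A ⊗ B) ⊗ (A ⊗ B)) : Prop :=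
  quasitriangular smash_mul smash_one smash_comul smash_counit R.

Definition right_conormal : Prop := forall (a : A) (b : B),
  \sum_(s <- terms (sigma (b ⊗ a))) counit s.1 *: s.2 = counit a *: b.

Definition left_normal : Prop := forall a : A, tau (a ⊗ 1) = 1 ⊗ a.

Variables (W : B ⊗ B) (X : A ⊗ B) (Y : B ⊗ A) (Z : A ⊗ A).

(* In the sums below, primes mark further copies of W, X, Y, Z (bars in the
   usual notation); for s in terms (sigma (b ⊗ a)), s.1 is a_σ and s.2 is b_σ;
   for t in terms (tau (a ⊗ b)), t.1 is b_τ and t.2 is a_τ. *)
Record quasitriangular_data : Prop := QuasitriangularData {
  C1 : forall a : A,
    \sum_(z <- terms Z) \sum_(x' <- terms X) \sum_(x <- terms X)
    \sum_(w <- terms W) \sum_(y <- terms Y) \sum_(d <- terms (comul a))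
    \sum_(s1 <- terms (sigma (x'.2 ⊗ y.2)))
    \sum_(s2 <- terms (sigma ((w.1 * y.1) ⊗ d.1)))
    \sum_(s3 <- terms (sigma ((x.2 * w.2) ⊗ d.2)))
      (counit s2.2 *: (z.1 * x'.1 * x.1 * s2.1)) ⊗
      ((counit s1.2 * counit s3.2) *: (z.2 * s1.1 * s3.1)) =
    \sum_(z <- terms Z) \sum_(d <- terms (comul a))
      (d.2 * z.1) ⊗ (d.1 * z.2);
  C2 : forall a : A,
    \sum_(x <- terms X) \sum_(w <- terms W)
    \sum_(s <- terms (sigma (w.1 ⊗ a)))
      (counit s.2 *: (x.1 * s.1)) ⊗ (x.2 * w.2) =
    \sum_(x <- terms X) (a * x.1) ⊗ x.2;
  C3 : forall a : A,
    \sum_(w <- terms W) \sum_(y <- terms Y)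
    \sum_(s <- terms (sigma (w.2 ⊗ a)))
      (w.1 * y.1) ⊗ (counit s.2 *: (y.2 * s.1)) =
    \sum_(y <- terms Y) y.1 ⊗ (a * y.2);
  C4 : forall b : B,
    \sum_(z <- terms Z) z.1 ⊗ (counit b *: z.2) =
    \sum_(z <- terms Z) \sum_(d <- terms (comul b))
    \sum_(t <- terms (tau (1 ⊗ d.1)))
    \sum_(s1 <- terms (sigma (d.2 ⊗ z.1)))
    \sum_(s2 <- terms (sigma (t.1 ⊗ z.2)))
      (counit s1.2 *: (t.2 * s1.1)) ⊗ (counit s2.2 *: s2.1);
  C5 : forall b : B,
    \sum_(x <- terms X) x.1 ⊗ (x.2 * b) =
    \sum_(x <- terms X) \sum_(d <- terms (comul b))
    \sum_(t <- terms (tau (1 ⊗ d.1)))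
    \sum_(s <- terms (sigma (d.2 ⊗ x.1)))
      (counit s.2 *: (t.2 * s.1)) ⊗ (t.1 * x.2);
  C6 : forall b : B,
    \sum_(w <- terms W) \sum_(y <- terms Y)
    \sum_(t <- terms (tau (1 ⊗ b)))
    \sum_(s <- terms (sigma (w.2 ⊗ t.2)))
      (w.1 * y.1 * t.1) ⊗ (counit s.2 *: (y.2 * s.1)) =
    \sum_(y <- terms Y) \sum_(s <- terms (sigma (b ⊗ y.2)))
      (s.2 * y.1) ⊗ s.1;
  C7 : forall b : B,
    \sum_(w <- terms W) \sum_(d <- terms (comul b))
      (w.1 * d.1) ⊗ (w.2 * d.2) =
    \sum_(w <- terms W) \sum_(d <- terms (comul b))
      (d.2 * w.1) ⊗ (d.1 * w.2);
  C8 :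
    \sum_(z <- terms Z) \sum_(d <- terms (comul z.1)) d.1 ⊗ (d.2 ⊗ z.2) =
    \sum_(z <- terms Z) \sum_(x <- terms X) \sum_(z' <- terms Z)
    \sum_(s <- terms (sigma (x.2 ⊗ z'.2)))
      (z.1 * x.1) ⊗ (z'.1 ⊗ (counit s.2 *: (z.2 * s.1)));
  C9 :
    \sum_(x <- terms X) \sum_(d <- terms (comul x.1)) d.1 ⊗ (d.2 ⊗ x.2) =
    \sum_(x <- terms X) \sum_(x' <- terms X)
      x.1 ⊗ (x'.1 ⊗ (x.2 * x'.2));
  C10 :
    \sum_(y <- terms Y) \sum_(z <- terms Z) \sum_(x <- terms X)
    \sum_(t <- terms (tau ((z.1 * x.1) ⊗ y.1)))
    \sum_(s <- terms (sigma (x.2 ⊗ y.2)))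
      t.1 ⊗ (t.2 ⊗ (counit s.2 *: (z.2 * s.1))) =
    \sum_(w <- terms W) \sum_(y <- terms Y) \sum_(z <- terms Z)
    \sum_(s <- terms (sigma (w.2 ⊗ z.2)))
      (w.1 * y.1) ⊗ (z.1 ⊗ (counit s.2 *: (y.2 * s.1)));
  C11 :
    \sum_(w <- terms W) \sum_(x <- terms X)
    \sum_(t <- terms (tau (x.1 ⊗ w.1)))
      t.1 ⊗ (t.2 ⊗ (x.2 * w.2)) =
    \sum_(w <- terms W) \sum_(x <- terms X)
      w.1 ⊗ (x.1 ⊗ (w.2 * x.2));
  C12 :
    \sum_(y <- terms Y) \sum_(d <- terms (comul y.1)) d.1 ⊗ (d.2 ⊗ y.2) =
    \sum_(w <- terms W) \sum_(y <- terms Y) \sum_(y' <- terms Y)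
    \sum_(s <- terms (sigma (w.2 ⊗ y'.2)))
      (w.1 * y.1) ⊗ (y'.1 ⊗ (counit s.2 *: (y.2 * s.1)));
  C13 :
    \sum_(w <- terms W) \sum_(d <- terms (comul w.1)) d.1 ⊗ (d.2 ⊗ w.2) =
    \sum_(w <- terms W) \sum_(w' <- terms W)
      w.1 ⊗ (w'.1 ⊗ (w.2 * w'.2));
  C14 :
    \sum_(z <- terms Z) \sum_(d <- terms (comul z.2)) z.1 ⊗ (d.1 ⊗ d.2) =
    \sum_(z <- terms Z) \sum_(x <- terms X) \sum_(z' <- terms Z)
    \sum_(y <- terms Y)
    \sum_(s1 <- terms (sigma (y.1 ⊗ z'.1)))
    \sum_(s2 <- terms (sigma (x.2 ⊗ y.2)))
      (counit s1.2 *: (z.1 * x.1 * s1.1)) ⊗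
      (z'.2 ⊗ (counit s2.2 *: (z.2 * s2.1)));
  C15 :
    \sum_(z <- terms Z) \sum_(x <- terms X)
    \sum_(t <- terms (tau (z.2 ⊗ x.2)))
      (z.1 * x.1) ⊗ (t.1 ⊗ t.2) =
    \sum_(z <- terms Z) \sum_(x <- terms X) \sum_(x' <- terms X)
    \sum_(y <- terms Y)
    \sum_(s1 <- terms (sigma (y.1 ⊗ x'.1)))
    \sum_(s2 <- terms (sigma (x.2 ⊗ y.2)))
      (counit s1.2 *: (z.1 * x.1 * s1.1)) ⊗
      (x'.2 ⊗ (counit s2.2 *: (z.2 * s2.1)));
  C16 :
    \sum_(x <- terms X) \sum_(d <- terms (comul x.2)) x.1 ⊗ (d.1 ⊗ d.2) =
    \sum_(x <- terms X) \sum_(x' <- terms X)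
      (x.1 * x'.1) ⊗ (x.2 ⊗ x'.2);
  C17 :
    \sum_(y <- terms Y) \sum_(d <- terms (comul y.2)) y.1 ⊗ (d.1 ⊗ d.2) =
    \sum_(y <- terms Y) \sum_(y' <- terms Y)
      (y.1 * y'.1) ⊗ (y'.2 ⊗ y.2);
  C18 :
    \sum_(w <- terms W) \sum_(y <- terms Y)
    \sum_(t <- terms (tau (y.2 ⊗ w.2)))
      (w.1 * y.1) ⊗ (t.1 ⊗ t.2) =
    \sum_(y <- terms Y) \sum_(w <- terms W)
      (y.1 * w.1) ⊗ (w.2 ⊗ y.2);
  C19 :
    \sum_(w <- terms W) \sum_(d <- terms (comul w.2)) w.1 ⊗ (d.1 ⊗ d.2) =
    \sum_(w <- terms W) \sum_(w' <- terms W)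
      (w.1 * w'.1) ⊗ (w'.2 ⊗ w.2)
}.

Definition alpha : (A ⊗ B) ⊗ (A ⊗ B) :=
  \sum_(z <- terms Z) \sum_(x' <- terms X) \sum_(x <- terms X)
  \sum_(w <- terms W) \sum_(y <- terms Y)
  \sum_(s <- terms (sigma (x'.2 ⊗ y.2)))
    ((z.1 * x'.1 * x.1) ⊗ (w.1 * y.1)) ⊗
    ((counit s.2 *: (z.2 * s.1)) ⊗ (x.2 * w.2)).

End SmashBiproduct.

(* Main.v *)
From mathcomp Require Import all_boot all_algebra.
Require Import Defs.
Set Implicit Arguments.
Unset Strict Implicit.
Unset Printing Implicit Defensive.
Import GRing.Theory.
Local Open Scope ring_scope.

(** Write H for the biproduct on A ⊗ B.  Right conormality of σ makes
    pB : a ⊗ b |-> ε(a) b an algebra map, left normality of τ makes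
    a |-> a ⊗ 1 a coalgebra map, and both maps are compatible with the other
    half of the structure as well: A is a subbialgebra of H and B a quotient
    bialgebra.  With pA : a ⊗ b |-> ε(b) a, every element is recovered from its
    coproduct as h = pA(h1) ⊗ pB(h2) ([scomul_pApB]).  Feeding products and
    coproducts of H into this formula shows that H is a bicrossed product:
    B acts on A by b ▷ a = a_σ ε(b_σ), it coacts by ρ(b) = τ(1 ⊗ b), and
<<
      σ(b ⊗ a) = (b1 ▷ a) ⊗ b2,      τ(a ⊗ b) = b0 ⊗ a b1
>>
    ([sigmaE], [tauE]), so that the 19 identities become identities about the
    action, the coaction and the two bialgebras ([qt_data]).

    From a quasitriangular structure R one gets W, X, Y, Z by projecting its
    two legs with pA and pB.  The 19 identities are the projections of
    (QT2)-(QT4).  Four basic rules suffice to evaluate them: they describe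
    what happens when one leg of R is multiplied by an element of H and then
    projected to A ([pA_mull_pB], [pA_mulr_pA], [pB_mulr_pA], [pA_mull_pA]).
    Splitting both legs of R by h = pA(h1) ⊗ pB(h2) and applying the same
    rules gives R = α ([R_eq]).

    Conversely, α is factored in two ways.  Along its first leg it is T U with
    T = Z1 X1 ⊗ (Z2 ⊗ X2) in A ⊗ H and U = W1 Y1 ⊗ (Y2 ⊗ W2) in B ⊗ H
    ([elR_TU]); both factors are multiplicative for the coproduct of the first
    leg and they commute up to τ ([cop_T], [cop_U], [TU_exch]), which is (QT2).
    Along its second leg it is built from V = (X1 ⊗ W1) ⊗ X2 W2 in H ⊗ B and
    S = (Z1 X1 ⊗ Y1) ⊗ Z2 (X2 ▷ Y2) in H ⊗ A ([elR_VS]); the same three facts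
    for V and S ([cop_V], [cop_S], [VS_exch]) are (QT3).  Finally (QT4) is
    multiplicative in h, so it has to be checked on the generators a ⊗ 1 and
    1 ⊗ b only, by moving them through the factors of α one at a time. *)

(** * Sweedler sums *)

Definition lin (k : fieldType) (U V : lmodType k) (f : U -> V) : Prop :=
  linear f.

Definition bilin (k : fieldType) (U V M : lmodType k) (f : U -> V -> M) :=
  (forall v, lin (fun u => f u v)) /\ (forall u, lin (fun v => f u v)).

(** For bilinear f this is the value at t of the linear map on U ⊗ V induced by
    f; iterating it renders the Sweedler notation for several tensors. *)
Definition sweedler (k : fieldType) (U V M : lmodType k) (t : U ⊗ V)
  (f : U -> V -> M) : M := \sum_(p <- terms t) f p.1 p.2.

Notation "∑( x ⊗ y <- t ) E" := (sweedler t (fun x y => E))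
  (at level 41, x name, y name, t at level 41, E at level 41,
   right associativity, format "'[' ∑( x  ⊗  y  <-  t ) '/  '  E ']'").
Notation "∑( x ⊗ y ⊗ z <- t ) E" := (sweedler t (fun x s => sweedler s (fun y z => E)))
  (at level 41, x name, y name, z name, t at level 41, E at level 41,
   right associativity, format "'[' ∑( x  ⊗  y  ⊗  z  <-  t ) '/  '  E ']'").

(** The comultiplication, with the linear structures in its type presented
    through [algCoalgType]: all tensor products over A then have syntactically
    equal types. *)
Definition cop (k : fieldType) (A : algCoalgType k) (a : A) : A ⊗ A := comul a.

(** Marks, inside an expression, the left-hand side of the equation which the
    next rewriting step replaces by its right-hand side. *)
Definition lhs (T : Type) (x y : T) (e : x = y) := x.
Arguments lhs T x y e : simpl never.

Section Sweedler.
Variable k : fieldType.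
Implicit Types U V M N P Q : lmodType k.

Lemma lin0 U V (f : U -> V) : lin f -> f 0 = 0.
Proof.
by move=> fl; have := fl (-1) 0 0; rewrite scaleN1r oppr0 addr0 scaleN1r addNr.
Qed.

Lemma linD U V (f : U -> V) u v : lin f -> f (u + v) = f u + f v.
Proof. by move=> fl; have := fl 1 u v; rewrite !scale1r. Qed.

Lemma linZ U V (f : U -> V) c u : lin f -> f (c *: u) = c *: f u.
Proof. by move=> fl; have := fl c u 0; rewrite addr0 (lin0 fl) addr0. Qed.

Lemma sw_tens U V M (u : U) (v : V) (f : U -> V -> M) :
  bilin f -> sweedler (u ⊗ v) f = f u v.
Proof. by case=> fl fr; apply: (sum_terms_tens fl fr). Qed.

Lemma sw_tensE U V (t : U ⊗ V) : ∑(u ⊗ v <- t) u ⊗ v = t.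
Proof. by rewrite /sweedler -tensor_sum. Qed.

Lemma sw_ext U V M (t : U ⊗ V) (f g : U -> V -> M) :
  (forall u v, f u v = g u v) -> sweedler t f = sweedler t g.
Proof. by move=> fg; apply: eq_bigr. Qed.

(** Sums over independent tensors commute whether or not f is multilinear. *)
Lemma sw_exch U V P Q M (s : U ⊗ V) (t : P ⊗ Q) (f : U -> V -> P -> Q -> M) :
  ∑(a ⊗ b <- s) ∑(c ⊗ d <- t) f a b c d =
  ∑(c ⊗ d <- t) ∑(a ⊗ b <- s) f a b c d.
Proof. exact: exchange_big. Qed.

Lemma lin_sw U V M N (L : M -> N) (t : U ⊗ V) (f : U -> V -> M) :
  lin L -> L (sweedler t f) = ∑(u ⊗ v <- t) L (f u v).
Proof.
move=> Ll; rewrite /sweedler; elim: (terms t) => [|p s IHs].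
  by rewrite !big_nil lin0.
by rewrite !big_cons linD // IHs.
Qed.

Lemma swZ U V M c (t : U ⊗ V) (f : U -> V -> M) :
  c *: sweedler t f = ∑(u ⊗ v <- t) c *: f u v.
Proof. exact: scaler_sumr. Qed.

Lemma lin_id U : lin (fun u : U => u). Proof. by []. Qed.

Lemma lin_tensl U V M (f : M -> U) (v : V) : lin f -> lin (fun m => f m ⊗ v).
Proof. by move=> fl c x y; rewrite fl tens_linearl. Qed.

Lemma lin_tensr U V M (f : M -> V) (u : U) : lin f -> lin (fun m => u ⊗ f m).
Proof. by move=> fl c x y; rewrite fl tens_linearr. Qed.

Lemma lin_scale U M c (f : M -> U) : lin f -> lin (fun m => c *: f m).
Proof. by move=> fl d x y; rewrite fl scalerDr !scalerA mulrC. Qed.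

Lemma lin_swr M U V N (t : U ⊗ V) (F : M -> U -> V -> N) :
  (forall u v, lin (fun m => F m u v)) -> lin (fun m => sweedler t (F m)).
Proof.
move=> Fl c x y; rewrite swZ -big_split; apply: eq_bigr => p _.
exact: Fl.
Qed.

Lemma lin_swl M U V N (t : M -> U ⊗ V) (g : U -> V -> N) :
  bilin g -> lin t -> lin (fun m => sweedler (t m) g).
Proof.
by move=> [gl gr] tl c x y; rewrite tl; apply: (sum_terms_linear gl gr).
Qed.

(** This flattens nested sums: an equation between tensors can be applied to
    any multilinear expression in their legs. *)
Lemma sw_bind U V P Q M (t : U ⊗ V) (f : U -> V -> P ⊗ Q) (g : P -> Q -> M) :
  bilin g -> sweedler (sweedler t f) g = ∑(u ⊗ v <- t) sweedler (f u v) g.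
Proof.
by move=> gb; apply: (lin_sw (L := fun s => sweedler s g)); apply: lin_swl.
Qed.

Lemma sw_scale U V M c (t : U ⊗ V) (g : U -> V -> M) :
  bilin g -> sweedler (c *: t) g = c *: sweedler t g.
Proof.
by move=> gb; apply: (linZ (f := fun s => sweedler s g)); apply: lin_swl.
Qed.

Lemma tensZl U V c (u : U) (v : V) : (c *: u) ⊗ v = c *: (u ⊗ v).
Proof. by apply: (linZ (f := fun u => u ⊗ v)); apply: lin_tensl. Qed.

Lemma tensZr U V c (u : U) (v : V) : u ⊗ (c *: v) = c *: (u ⊗ v).
Proof. by apply: (linZ (f := fun v => u ⊗ v)); apply: lin_tensr. Qed.

Variables A : algCoalgType k.
Lemma lin_mull M (f : M -> A) (a : A) : lin f -> lin (fun m => f m * a).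
Proof. by move=> fl c x y; rewrite fl mulrDl scalerAl. Qed.

Lemma lin_mulr M (f : M -> A) (a : A) : lin f -> lin (fun m => a * f m).
Proof. by move=> fl c x y; rewrite fl mulrDr scalerAr. Qed.

Lemma lin_cop M (f : M -> A) : lin f -> lin (fun m => cop (f m)).
Proof.
by move=> fl c x y; rewrite fl; apply: (coalg_linear (@comul_coalgebra k A)).
Qed.

Lemma lin_counit M N (f : M -> A) (n : N) :
  lin f -> lin (fun m => counit (f m) *: n).
Proof.
move=> fl c x y; rewrite fl (coalg_scalar (@comul_coalgebra k A)).
by rewrite scalerDl -scalerA.
Qed.
End Sweedler.

Section CoalgebraCalculus.
Variables (k : fieldType).
Lemma counitl (A : algCoalgType k) (a : A) :
  ∑(a1 ⊗ a2 <- cop a) counit a1 *: a2 = a.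
Proof. exact: (coalg_counitl (@comul_coalgebra k A)). Qed.

Lemma counitr (A : algCoalgType k) (a : A) :
  ∑(a1 ⊗ a2 <- cop a) counit a2 *: a1 = a.
Proof. exact: (coalg_counitr (@comul_coalgebra k A)). Qed.

Lemma coassoc (A : algCoalgType k) (a : A) :
  ∑(a1 ⊗ a2 <- cop a) ∑(c ⊗ d <- cop a1) c ⊗ (d ⊗ a2) =
  ∑(a1 ⊗ a2 <- cop a) ∑(c ⊗ d <- cop a2) a1 ⊗ (c ⊗ d).
Proof. exact: (coalg_coassoc (@comul_coalgebra k A)). Qed.

Lemma tens_eq (U V M : lmodType k) (f g : U ⊗ V -> M) t :
  lin f -> lin g -> (forall u v, f (u ⊗ v) = g (u ⊗ v)) -> f t = g t.
Proof.
move=> fl gl fg; rewrite -[t]sw_tensE (lin_sw _ _ fl) (lin_sw _ _ gl).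
exact: sw_ext.
Qed.

Lemma mulZl (A : algCoalgType k) c (a b : A) : (c *: a) * b = c *: (a * b).
Proof. by rewrite scalerAl. Qed.

Lemma mulZr (A : algCoalgType k) c (a b : A) : a * (c *: b) = c *: (a * b).
Proof. by rewrite scalerAr. Qed.

Lemma counitZ (A : algCoalgType k) (a : A) c : counit (c *: a) = c * counit a.
Proof.
have := coalg_scalar (@comul_coalgebra k A) c a 0.
have := coalg_scalar (@comul_coalgebra k A) (-1) 0 0.
by rewrite scaleN1r oppr0 addr0 mulN1r addNr => ->; rewrite !addr0.
Qed.
End CoalgebraCalculus.

(** * The action, the coaction and the two projections *)

Section SmashBiproduct.
Variables (k : fieldType) (A B : algCoalgType k).
Variables (sigma : {linear (B ⊗ A)%type -> (A ⊗ B)%type}).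
Variables (tau : {linear (A ⊗ B)%type -> (B ⊗ A)%type}).
Notation "x ⋆ y" := (smash_mul sigma x y) (at level 40, left associativity).
Notation Δ := (smash_comul tau).
Implicit Types (a : A) (b : B) (x y h : A ⊗ B).

(** It turns out to be a module algebra structure ([actM], [act_mul]). *)
Definition act (b : B) (a : A) : A :=
  ∑(a' ⊗ b' <- sigma (b ⊗ a)) counit b' *: a'.
Lemma actE b a : act b a = ∑(a' ⊗ b' <- sigma (b ⊗ a)) counit b' *: a'.
Proof. by []. Qed.
Notation "b ▷ a" := (act b a) (at level 37, right associativity).
(** The coaction of A on B; it is multiplicative up to the action ([rhoM]). *)
Definition rho (b : B) : B ⊗ A := tau (1 ⊗ b).

Lemma lin_sigma (M : lmodType k) (f : M -> B ⊗ A) :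
  lin f -> lin (fun m => sigma (f m)).
Proof. by move=> fl c x y; rewrite fl linearP. Qed.

Lemma lin_tau (M : lmodType k) (f : M -> A ⊗ B) :
  lin f -> lin (fun m => tau (f m)).
Proof. by move=> fl c x y; rewrite fl linearP. Qed.

Lemma lin_rho (M : lmodType k) (f : M -> B) :
  lin f -> lin (fun m => rho (f m)).
Proof. by move=> fl; apply: lin_tau; apply: lin_tensr. Qed.

Lemma bilin_counitr : bilin (fun (a : A) (b : B) => counit b *: a).
Proof. by split=> ?; [apply: lin_scale | apply: lin_counit]. Qed.

Lemma lin_actl (M : lmodType k) (f : M -> B) a :
  lin f -> lin (fun m => act (f m) a).
Proof.
by move=> fl; exact/(lin_swl bilin_counitr)/lin_sigma/lin_tensl.
Qed.

Lemma lin_actr (M : lmodType k) (f : M -> A) b :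
  lin f -> lin (fun m => act b (f m)).
Proof.
by move=> fl; exact/(lin_swl bilin_counitr)/lin_sigma/lin_tensr.
Qed.

Lemma smash_mulE x y : x ⋆ y = ∑(a ⊗ b <- x) ∑(a' ⊗ b' <- y)
  ∑(c ⊗ d <- sigma (b ⊗ a')) (a * c) ⊗ (d * b').
Proof. by []. Qed.

Lemma lin_smull (M : lmodType k) (f : M -> A ⊗ B) y :
  lin f -> lin (fun m => f m ⋆ y).
Proof.
move=> fl.
pose g a b := ∑(a' ⊗ b' <- y) ∑(c ⊗ d <- sigma (b ⊗ a')) (a * c) ⊗ (d * b').
apply: (lin_swl (g := g)) => //; split=> u.
  by apply: lin_swr => a' b'; apply: lin_swr => c d; apply/lin_tensl/lin_mull.
apply: lin_swr => a' b'; apply: lin_swl; last exact/lin_sigma/lin_tensl.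
by split=> v; [apply/lin_tensl/lin_mulr | apply/lin_tensr/lin_mull].
Qed.

Lemma lin_smulr (M : lmodType k) (f : M -> A ⊗ B) x :
  lin f -> lin (fun m => x ⋆ f m).
Proof.
move=> fl.
pose g a b a' b' := ∑(c ⊗ d <- sigma (b ⊗ a')) (a * c) ⊗ (d * b').
apply: (@lin_swr _ _ _ _ _ x (fun m a b => sweedler (f m) (g a b))) => a b.
apply: (lin_swl _ fl); split=> u.
  apply: lin_swl; last exact/lin_sigma/lin_tensr.
  by split=> v; [apply/lin_tensl/lin_mulr | apply/lin_tensr/lin_mull].
by apply: lin_swr => c d; apply/lin_tensr/lin_mulr.
Qed.

Lemma smash_comulE x : Δ x = ∑(a ⊗ b <- x) ∑(a1 ⊗ a2 <- cop a)
  ∑(b1 ⊗ b2 <- cop b) ∑(c ⊗ d <- tau (a2 ⊗ b1)) (a1 ⊗ c) ⊗ (d ⊗ b2).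
Proof. by []. Qed.

Lemma lin_scomul (M : lmodType k) (f : M -> A ⊗ B) :
  lin f -> lin (fun m => Δ (f m)).
Proof.
move=> fl.
pose g a b := ∑(a1 ⊗ a2 <- cop a) ∑(b1 ⊗ b2 <- cop b)
  ∑(c ⊗ d <- tau (a2 ⊗ b1)) (a1 ⊗ c) ⊗ (d ⊗ b2).
have bt (u : A) (v : B) : bilin (fun b a => (u ⊗ b) ⊗ (a ⊗ v)).
  by split=> w; [apply/lin_tensl/lin_tensr | apply/lin_tensr/lin_tensl].
apply: (lin_swl (g := g)) => //; split=> u.
  apply: lin_swl; last exact/lin_cop.
  split=> v; apply: lin_swr => d1 d2; last by apply: lin_swl; [exact: bt | apply/lin_tau/lin_tensl].
  by apply: lin_swr => t1 t2; apply/lin_tensl/lin_tensl.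
apply: lin_swr => a1 a2; apply: lin_swl; last exact/lin_cop.
split=> v; first by apply: lin_swl; [exact: bt | apply/lin_tau/lin_tensr].
by apply: lin_swr => t1 t2; apply/lin_tensr/lin_tensr.
Qed.

Definition pA (h : A ⊗ B) : A := ∑(a ⊗ b <- h) counit b *: a.
Definition pB (h : A ⊗ B) : B := ∑(a ⊗ b <- h) counit a *: b.
Lemma bilin_counitl : bilin (fun (a : A) (b : B) => counit a *: b).
Proof. by split=> ?; [apply: lin_counit | apply: lin_scale]. Qed.

Lemma lin_pA (M : lmodType k) (f : M -> A ⊗ B) :
  lin f -> lin (fun m => pA (f m)).
Proof. exact/(lin_swl bilin_counitr). Qed.

Lemma lin_pB (M : lmodType k) (f : M -> A ⊗ B) :
  lin f -> lin (fun m => pB (f m)).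
Proof. exact/(lin_swl bilin_counitl). Qed.

Lemma pA_tens a b : pA (a ⊗ b) = counit b *: a.
Proof. exact: (sw_tens _ _ bilin_counitr). Qed.

Lemma pB_tens a b : pB (a ⊗ b) = counit a *: b.
Proof. exact: (sw_tens _ _ bilin_counitl). Qed.

Lemma lin_scounit (M N : lmodType k) (f : M -> A ⊗ B) (n : N) :
  lin f -> lin (fun m => @smash_counit _ A B (f m) *: n).
Proof.
move=> fl; have E h : @smash_counit _ A B h *: n = ∑(a ⊗ b <- h) counit a *: (counit b *: n).
  by rewrite /smash_counit scaler_suml; apply: eq_bigr => p _; rewrite scalerA.
move=> c x y; rewrite !E; move: c x y; apply: lin_swl fl.
by split=> ?; [apply: lin_counit | apply/lin_scale/lin_counit].
Qed.

Lemma smash_counit_tens a b : @smash_counit _ A B (a ⊗ b) = counit a * counit b.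
Proof.
apply: (sum_terms_tens (W := k^o) (f := fun a b => counit a * counit b)).
  move=> v c x y /=; rewrite (coalg_scalar (@comul_coalgebra k A)).
  by rewrite mulrDl -mulrA.
move=> u c x y /=; rewrite (coalg_scalar (@comul_coalgebra k B)).
by rewrite mulrDr !mulrA [_ * c]mulrC -!mulrA.
Qed.

Lemma actZl c b a : (c *: b) ▷ a = c *: (b ▷ a).
Proof. by apply: (linZ (f := act^~ a)); apply: lin_actl. Qed.

Lemma actZr c b a : b ▷ (c *: a) = c *: (b ▷ a).
Proof. by apply: (linZ (f := act b)); apply: lin_actr. Qed.

Lemma pAZ c h : pA (c *: h) = c *: pA h.
Proof. by apply: (linZ (f := pA)); apply: lin_pA. Qed.

Lemma pBZ c h : pB (c *: h) = c *: pB h.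
Proof. by apply: (linZ (f := pB)); apply: lin_pB. Qed.

Lemma smulZl c x y : (c *: x) ⋆ y = c *: (x ⋆ y).
Proof. by apply: (linZ (f := (smash_mul sigma)^~ y)); apply: lin_smull. Qed.

Lemma smulZr c x y : x ⋆ (c *: y) = c *: (x ⋆ y).
Proof. by apply: (linZ (f := smash_mul sigma x)); apply: lin_smulr. Qed.

(** * Deciding equality of Sweedler expressions *)

(** Linearity of an expression in one of its variables, by recursion on the
    expression. *)
Ltac solve_lin := cbv beta; lazymatch goal with
  | |- bilin _ => split; intros; solve_lin
  | |- lin (fun u => u) => exact: lin_id
  | |- lin (fun u => sweedler _ _) => first [apply lin_swr; intros | apply lin_swl]; solve_lin
  | |- lin (fun u => _ ⊗ _) => first [apply lin_tensl | apply lin_tensr]; solve_lin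
  | |- lin (fun u => GRing.mul _ _) => first [apply lin_mull | apply lin_mulr]; solve_lin
  | |- lin (fun u => act _ _) => first [apply lin_actl | apply lin_actr]; solve_lin
  | |- lin (fun u => cop _) => apply lin_cop; solve_lin
  | |- lin (fun u => rho _) => apply lin_rho; solve_lin
  | |- lin (fun u => _ *: _) => 
      first [apply lin_counit | apply lin_scale | apply lin_scounit]; solve_lin
  | |- lin (fun u => pA _) => apply lin_pA; solve_lin
  | |- lin (fun u => pB _) => apply lin_pB; solve_lin
  | |- lin (fun u => smash_mul _ _ _) => first [apply lin_smull | apply lin_smulr]; solve_lin
  | |- lin (fun u => smash_comul _ _) => apply lin_scomul; solve_lin
  | |- lin (fun u => GRing.Linear.sort _ _) => first [apply lin_sigma | apply lin_tau]; solve_lin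
  | |- lin (fun u => _) => fail
  | |- lin ?f => change (lin (fun u => f u)); solve_lin
  end.

(** Brings the n-th sum of a nest of sums to the front. *)
Ltac sw_pull n := lazymatch n with
  | O => reflexivity
  | S ?m => lazymatch goal with
    | |- sweedler _ _ = _ =>
      etransitivity; [apply sw_ext; intros ? ?; cbv beta; sw_pull m | apply sw_exch]
    end
  end.

(** Equality of two products of scalars up to order; the budget bounds the
    number of rotations of the right-hand side. *)
Ltac mul_ac n := lazymatch n with
  | O => reflexivity
  | S ?m => first [ reflexivity
    | lazymatch goal with |- _ * ?x = _ * ?x' =>
        constr_eq x x'; apply (f_equal (fun z => z * x)); mul_ac (6%N) end
    | rewrite [RHS]mulrC ?mulrA; mul_ac m ]
  end.
Ltac leaf_eq := first [ reflexivity
  | lazymatch goal with |- _ *: _ = _ *: _ => apply: f_equal2; [mul_ac (6%N) | reflexivity] end ].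

(** The comparison used by [sw_match] to recognize the same tensor in two
    nests of sums. *)
Ltac same_tensor t t' := constr_eq t t'.

(** Two flat nests of sums are equal when they have the same summand after a
    permutation of the sums.  The same tensor may be summed over several times,
    so the matching copy has to be found by backtracking. *)
Ltac sw_match := cbv beta; lazymatch goal with
  | |- sweedler ?t _ = sweedler ?t' _ => first
     [ same_tensor t t'; apply sw_ext; intros ? ?; sw_match
     | sw_match_at (1%N) | sw_match_at (2%N) | sw_match_at (3%N)
     | sw_match_at (4%N) | sw_match_at (5%N) | sw_match_at (6%N)
     | sw_match_at (7%N) | sw_match_at (8%N) | sw_match_at (9%N)
     | sw_match_at (10%N) | sw_match_at (11%N) | sw_match_at (12%N)]
  | |- sweedler _ _ = _ => fail
  | |- _ = sweedler _ _ => fail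
  | |- _ => leaf_eq
  end
with sw_match_at n :=
  refine (eq_trans _ (esym _)); [|
    let m := eval compute in n in sw_pull m ]; cbv beta;
  lazymatch goal with |- sweedler ?t _ = sweedler ?t' _ => same_tensor t t' end;
  apply sw_ext; intros ? ?; sw_match.

(** Expansions that depend on the structure at hand: of a tensor that is summed
    over ([head_rule]), of a subterm of the summand into a sum ([leaf_rule]), and
    of a subterm of the summand into a single term ([leaf_simp]).  Each new
    structure formula below is added to them. *)
Ltac head_rule t := fail.
Ltac leaf_rule pull := fail.
Ltac leaf_simp := rewrite ?(mulZl, mulZr, tensZl, tensZr, actZl, actZr, pAZ,
  pBZ, smulZl, smulZr,
  counitZ, pA_tens, pB_tens, smash_counit_tens, scalerA, mulrA, mul1r, mulr1, scale1r).

(** Rewrites an expression into a flat nest of sums over atomic tensors.  Sums,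
    scalars and pure tensors are pulled out by multilinearity.  A marked
    equation is unfolded to its left-hand side, or replaced by its right-hand
    side when [fire] is true. *)
Ltac norm fire := cbv beta; lazymatch goal with
  | |- sweedler (lhs ?e) ?g = _ =>
    lazymatch fire with
    | true => etransitivity; [exact (f_equal (fun z0 => sweedler z0 g) e) | norm fire]
    | false => lazymatch type of e with ?x = _ => change (lhs e) with x; norm fire end
    end
  | |- sweedler (sweedler _ _) _ = _ => etransitivity; [apply sw_bind; solve_lin | norm fire]
  | |- sweedler (_ ⊗ _) _ = _ => etransitivity; [apply sw_tens; solve_lin | norm fire]
  | |- sweedler (_ *: _) _ = _ => etransitivity; [apply sw_scale; solve_lin | norm fire]
  | |- sweedler ?t ?g = _ =>
    tryif (etransitivity; [refine (f_equal (fun z0 => sweedler z0 g) _); head_rule t |])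
    then norm fire else
      lazymatch t with
        | context [@lhs ?T ?x ?y ?e] => norm_lhs fire e (@lhs T x y e) x
        | context [@sweedler ?k ?U ?V ?M ?t' ?f'] =>
            norm_pull fire (@sweedler k U V M t' f') (erefl (@sweedler k U V M t' f'))
        | context [@GRing.scale ?R ?M ?c ?v] =>
            norm_scale fire c v (@GRing.scale R M c v)
        | _ => apply sw_ext; intros ? ?; norm fire
      end
  | |- context [@lhs ?T ?x ?y ?e] => norm_lhs fire e (@lhs T x y e) x
  | |- _ => leaf_simp; first [leaf_rule ltac:(fun u E => norm_pull fire u E)
     | lazymatch goal with |- context [@sweedler ?k ?U ?V ?M ?t ?f] =>
      norm_pull fire (@sweedler k U V M t f) (erefl (@sweedler k U V M t f)) end
     | lazymatch goal with
       | |- _ *: ?e = _ => lazymatch e with context [@GRing.scale ?R ?M ?c ?v] =>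
            norm_scale fire c v (@GRing.scale R M c v) end
       | |- ?e = _ => lazymatch e with context [@GRing.scale ?R ?M ?c ?v] =>
            norm_scale fire c v (@GRing.scale R M c v) end
       end
     | reflexivity ]
  end
with norm_lhs fire e u x :=
    lazymatch fire with
    | true => norm_rw fire u e
    | false => change u with x; norm fire
    end
with norm_scale fire c v u :=
  lazymatch goal with |- ?l = _ =>
    lazymatch eval pattern u in l with
    | ?L _ => etransitivity; [apply (@linZ _ _ _ L c v); solve_lin |]; norm fire
    end
  end
with norm_rw fire u E :=
  lazymatch goal with |- ?l = _ =>
    lazymatch eval pattern u in l with
    | ?L _ => etransitivity; [exact (f_equal L E) |]; norm fire
    end
  end
with norm_pull fire u E :=
  lazymatch goal with |- ?l = _ =>
    lazymatch eval pattern u in l with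
    | ?L _ => etransitivity; [exact (f_equal L E) |];
       etransitivity; [apply (@lin_sw _ _ _ _ _ L); solve_lin |]; norm fire
    end
  end.

(** Equality of two Sweedler expressions by their normal forms. *)
Ltac sweq := cbv beta; refine (eq_trans _ (eq_trans _ (esym _)));
  [norm false | | norm false]; sw_match.

(** One step of a Sweedler computation: E is the current expression, arranged
    so that the left-hand side of an equation is visible and marked; the goal
    continues from E with that equation applied. *)
Ltac step E := transitivity E; [sweq | etransitivity; [norm true|]].

(** An equation that is linear in h needs a proof for pure tensors only. *)
Ltac tensP h := lazymatch goal with |- ?l = ?r =>
  lazymatch eval pattern h in l with ?f _ =>
  lazymatch eval pattern h in r with ?g _ =>
    apply: (@tens_eq _ _ _ _ f g h); [solve_lin | solve_lin | cbv beta]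
  end end end.

(** * The biproduct as a bicrossed product *)

Record setting : Prop := Setting {
  set_bialg : smash_biproduct_bialgebra sigma tau;
  set_algA : counital_algebra A;
  set_algB : counital_algebra B;
  set_coalgA : unital_coalgebra A;
  set_coalgB : unital_coalgebra B;
  set_conormal : right_conormal sigma;
  set_normal : left_normal tau }.

Hypothesis HS : setting.

Lemma counitMA a a' : counit (a * a') = counit a * counit a'.
Proof. by case: (set_algA HS). Qed.

Lemma counitMB b b' : counit (b * b') = counit b * counit b'.
Proof. by case: (set_algB HS). Qed.

Lemma counit1A : counit (1 : A) = 1. Proof. by case: (set_algA HS). Qed.

Lemma counit1B : counit (1 : B) = 1. Proof. by case: (set_algB HS). Qed.

Lemma comul1A : cop (1 : A) = 1 ⊗ 1. Proof. by case: (set_coalgA HS). Qed.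

Lemma comul1B : cop (1 : B) = 1 ⊗ 1. Proof. by case: (set_coalgB HS). Qed.

Lemma smulA x y h : x ⋆ (y ⋆ h) = (x ⋆ y) ⋆ h.
Proof. exact: (alg_assoc (bialg_alg (set_bialg HS))). Qed.

Lemma smul1 x : (1 ⊗ 1) ⋆ x = x.
Proof. exact: (alg_unitl (bialg_alg (set_bialg HS))). Qed.

Lemma smulr1 x : x ⋆ (1 ⊗ 1) = x.
Proof. exact: (alg_unitr (bialg_alg (set_bialg HS))). Qed.

Lemma scomulM x y : Δ (x ⋆ y) =
  ∑(x1 ⊗ x2 <- Δ x) ∑(y1 ⊗ y2 <- Δ y) (x1 ⋆ y1) ⊗ (x2 ⋆ y2).
Proof. exact: (bialg_comulM (set_bialg HS)). Qed.

Lemma scounitl h : ∑(x ⊗ y <- Δ h) @smash_counit _ A B x *: y = h.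
Proof. exact: (coalg_counitl (bialg_coalg (set_bialg HS))). Qed.

Lemma scounitr h : ∑(x ⊗ y <- Δ h) @smash_counit _ A B y *: x = h.
Proof. exact: (coalg_counitr (bialg_coalg (set_bialg HS))). Qed.

Lemma scoassoc h :
  ∑(x ⊗ y <- Δ h) ∑(u ⊗ v <- Δ x) u ⊗ (v ⊗ y) =
  ∑(x ⊗ y <- Δ h) ∑(u ⊗ v <- Δ y) x ⊗ (u ⊗ v).
Proof. exact: (coalg_coassoc (bialg_coalg (set_bialg HS))). Qed.

Lemma smul_tens a b a' b' : (a ⊗ b) ⋆ (a' ⊗ b') =
  ∑(c ⊗ d <- sigma (b ⊗ a')) (a * c) ⊗ (d * b').
Proof. by rewrite smash_mulE; etransitivity; [norm false|reflexivity]. Qed.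

Lemma scomul_tens a b : Δ (a ⊗ b) =
  ∑(a1 ⊗ a2 <- cop a) ∑(b1 ⊗ b2 <- cop b)
  ∑(c ⊗ d <- tau (a2 ⊗ b1)) (a1 ⊗ c) ⊗ (d ⊗ b2).
Proof. by rewrite smash_comulE; etransitivity; [norm false|reflexivity]. Qed.

Ltac leaf_simp ::= rewrite ?(mulZl, mulZr, tensZl, tensZr, actZl, actZr, pAZ,
  pBZ, smulZl, smulZr,
  counitZ, pA_tens, pB_tens, smash_counit_tens, scalerA, mulrA, mul1r, mulr1, scale1r,
  counitMA, counitMB, counit1A, counit1B).
Ltac head_rule t ::= lazymatch t with
  | smash_comul _ (?a ⊗ ?b) => exact (scomul_tens a b)
  | cop 1 => first [exact comul1A | exact comul1B]
  end.

Lemma sigma_1r b : sigma (b ⊗ 1) = 1 ⊗ b.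
Proof.
rewrite -[RHS]smulr1 smul_tens -[LHS]sw_tensE; apply: sw_ext => c d.
by rewrite mul1r mulr1.
Qed.

Lemma sigma_1l a : sigma (1 ⊗ a) = a ⊗ 1.
Proof.
rewrite -[RHS]smul1 smul_tens -[LHS]sw_tensE; apply: sw_ext => c d.
by rewrite mul1r mulr1.
Qed.

(** The counit axiom of the smash coproduct at a ⊗ b, where the two remaining
    comultiplications collapse. *)
Lemma tau_counitl a b :
  ∑(c ⊗ d <- tau (a ⊗ b)) counit c *: d = counit b *: a.
Proof.
rewrite -pA_tens -[X in _ = pA X]scounitl; symmetry.
by step (∑(c ⊗ d <- tau (lhs (counitl a) ⊗ lhs (counitr b))) counit c *: d); sweq.
Qed.

Lemma tau_counitr a b :
  ∑(c ⊗ d <- tau (a ⊗ b)) counit d *: c = counit a *: b.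
Proof.
rewrite -pB_tens -[X in _ = pB X]scounitr; symmetry.
by step (∑(c ⊗ d <- tau (lhs (counitl a) ⊗ lhs (counitr b))) counit d *: c); sweq.
Qed.

(** This is where right conormality of σ enters. *)
Lemma pB_mul x y : pB (x ⋆ y) = pB x * pB y.
Proof.
tensP x => a b; tensP y => a' b'.
have E : ∑(c ⊗ d <- sigma (b ⊗ a')) counit c *: d = counit a' *: b.
  exact: (set_conormal HS).
rewrite smul_tens.
by step (counit a *: (lhs E * b')); sweq.
Qed.

Lemma cop_pA h : cop (pA h) = ∑(x ⊗ y <- Δ h) pA x ⊗ pA y.
Proof.
tensP h => a b; rewrite pA_tens -[cop _]sw_tensE; symmetry.
step (∑(a1 ⊗ a2 <- cop a) ∑(b1 ⊗ b2 <- cop b)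
  a1 ⊗ (counit b2 *: lhs (tau_counitl a2 b1))).
by step (∑(a1 ⊗ a2 <- cop a) counit (lhs (counitl b)) *: (a1 ⊗ a2)); sweq.
Qed.

Lemma cop_pB h : cop (pB h) = ∑(x ⊗ y <- Δ h) pB x ⊗ pB y.
Proof.
tensP h => a b; rewrite pB_tens -[cop _]sw_tensE; symmetry.
step (∑(a1 ⊗ a2 <- cop a) ∑(b1 ⊗ b2 <- cop b)
  (counit a1 *: lhs (tau_counitr a2 b1)) ⊗ b2).
by step (∑(b1 ⊗ b2 <- cop b) counit (lhs (counitl a)) *: (b1 ⊗ b2)); sweq.
Qed.

(** The reconstruction formula h = pA(h1) ⊗ pB(h2); it holds for every smash
    coproduct, since τ is compatible with the counits. *)
Lemma scomul_pApB h : ∑(x ⊗ y <- Δ h) pA x ⊗ pB y = h.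
Proof.
tensP h => a b.
step (∑(a1 ⊗ a2 <- cop a) ∑(b1 ⊗ b2 <- cop b)
  a1 ⊗ (counit (lhs (tau_counitl a2 b1)) *: b2)).
by step (lhs (counitr a) ⊗ lhs (counitl b)); sweq.
Qed.

(** Projecting the other way round gives back τ itself. *)
Lemma scomul_pBpA h : ∑(x ⊗ y <- Δ h) pB x ⊗ pA y = ∑(a ⊗ b <- h) tau (a ⊗ b).
Proof.
tensP h => a b; transitivity (tau (a ⊗ b)); last by rewrite sw_tens //; solve_lin.
rewrite -[RHS]sw_tensE.
by step (∑(c ⊗ d <- tau (lhs (counitl a) ⊗ lhs (counitr b))) c ⊗ d); sweq.
Qed.

(** Left normality of τ: a |-> a ⊗ 1 is comultiplicative. *)
Lemma scomul_l a : Δ (a ⊗ 1) = ∑(a1 ⊗ a2 <- cop a) (a1 ⊗ 1) ⊗ (a2 ⊗ 1).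
Proof.
rewrite scomul_tens; apply: sw_ext => a1 a2; rewrite comul1B sw_tens; last by solve_lin.
by rewrite (set_normal HS) sw_tens //; solve_lin.
Qed.

Lemma scomul_r b : Δ (1 ⊗ b) =
  ∑(b1 ⊗ b2 <- cop b) ∑(c ⊗ d <- rho b1) (1 ⊗ c) ⊗ (d ⊗ b2).
Proof. by rewrite scomul_tens comul1A sw_tens //; solve_lin. Qed.

Lemma pA_smul a b y : pA ((a ⊗ b) ⋆ y) = a * (b ▷ pA y).
Proof.
tensP y => a' b'; rewrite smul_tens.
transitivity (∑(c ⊗ d <- sigma (b ⊗ a')) counit b' *: (a * (counit d *: c))).
  by sweq.
by rewrite pA_tens actZr actE; sweq.
Qed.

Lemma rho_counitl b : ∑(c ⊗ d <- rho b) counit c *: d = counit b *: 1.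
Proof. exact: tau_counitl. Qed.

Lemma rho_counitr b : ∑(c ⊗ d <- rho b) counit d *: c = b.
Proof. by rewrite tau_counitr counit1A scale1r. Qed.

Ltac leaf_simp ::= rewrite ?(mulZl, mulZr, tensZl, tensZr, actZl, actZr, pAZ,
  pBZ, smulZl, smulZr,
  counitZ, pA_tens, pB_tens, smash_counit_tens, scalerA, mulrA, mul1r, mulr1, scale1r,
  counitMA, counitMB, counit1A, counit1B, pA_smul, pB_mul).
Ltac head_rule t ::= lazymatch t with
  | smash_comul _ (_ ⊗ 1) => exact (scomul_l _)
  | smash_comul _ (1 ⊗ _) => exact (scomul_r _)
  | smash_comul _ (?a ⊗ ?b) => exact (scomul_tens a b)
  | smash_comul _ (smash_mul _ ?x ?y) => exact (scomulM x y)
  | cop 1 => first [exact comul1A | exact comul1B]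
  end.

Lemma smul_ba b a : (1 ⊗ b) ⋆ (a ⊗ 1) = sigma (b ⊗ a).
Proof. by rewrite smul_tens -[RHS]sw_tensE; apply: sw_ext => c d; rewrite mul1r mulr1. Qed.

Lemma smul_ab a b : (a ⊗ 1) ⋆ (1 ⊗ b) = a ⊗ b.
Proof. by rewrite smul_tens sigma_1r sw_tens ?mulr1 ?mul1r //; solve_lin. Qed.

Lemma smul_aa a a' : (a ⊗ 1) ⋆ (a' ⊗ 1) = (a * a') ⊗ 1.
Proof. by rewrite smul_tens sigma_1l sw_tens ?mulr1 //; solve_lin. Qed.

Lemma smul_bb b b' : (1 ⊗ b) ⋆ (1 ⊗ b') = 1 ⊗ (b * b').
Proof. by rewrite smul_tens sigma_1r sw_tens ?mul1r //; solve_lin. Qed.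

(** The reconstruction formula for σ(b ⊗ a) = (1 ⊗ b)(a ⊗ 1), whose coproduct
    is known because that of H is multiplicative. *)
Lemma sigmaE b a : sigma (b ⊗ a) = ∑(b1 ⊗ b2 <- cop b) (b1 ▷ a) ⊗ b2.
Proof.
rewrite -smul_ba -[LHS]scomul_pApB.
by step (∑(b1 ⊗ b2 <- cop b) (lhs (rho_counitr b1) ▷ lhs (counitr a)) ⊗ b2); sweq.
Qed.

Lemma smulE a b a' b' : (a ⊗ b) ⋆ (a' ⊗ b') =
  ∑(b1 ⊗ b2 <- cop b) (a * (b1 ▷ a')) ⊗ (b2 * b').
Proof. by rewrite smul_tens sigmaE; sweq. Qed.

Lemma act1 a : 1 ▷ a = a.
Proof. by rewrite actE sigma_1l sw_tens ?counit1B ?scale1r //; solve_lin. Qed.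

Lemma act_unit b : b ▷ 1 = counit b *: 1.
Proof. by rewrite actE sigma_1r sw_tens //; solve_lin. Qed.

Lemma actM b b' a : (b * b') ▷ a = b ▷ (b' ▷ a).
Proof.
have := congr1 pA (smulA (1 ⊗ b) (1 ⊗ b') (a ⊗ 1)).
by rewrite smul_bb !pA_smul !mul1r !pA_tens !counit1B !scale1r.
Qed.

Ltac leaf_simp ::= rewrite ?(mulZl, mulZr, tensZl, tensZr, actZl, actZr, pAZ,
  pBZ, smulZl, smulZr,
  counitZ, pA_tens, pB_tens, smash_counit_tens, scalerA, mulrA, mul1r, mulr1, scale1r,
  counitMA, counitMB, counit1A, counit1B, pA_smul, pB_mul, act1, act_unit, actM).
(** The dual of [sigmaE]: project the coproduct of a ⊗ b = (a ⊗ 1)(1 ⊗ b) to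
    B ⊗ A. *)
Lemma tauE a b : tau (a ⊗ b) = ∑(c ⊗ d <- rho b) c ⊗ (a * d).
Proof.
transitivity (∑(a ⊗ b <- a ⊗ b) tau (a ⊗ b)); first by rewrite sw_tens //; solve_lin.
rewrite -scomul_pBpA -{1}smul_ab.
by step (∑(c ⊗ d <- rho (lhs (counitr b))) c ⊗ (lhs (counitl a) * d)); sweq.
Qed.

(** Associativity of the product (1 ⊗ b)(a ⊗ 1)(a' ⊗ 1), projected to A. *)
Lemma act_mul b a a' : b ▷ (a * a') = ∑(b1 ⊗ b2 <- cop b) (b1 ▷ a) * (b2 ▷ a').
Proof.
have := congr1 pA (smulA (1 ⊗ b) (a ⊗ 1) (a' ⊗ 1)).
rewrite smul_aa !pA_smul smul_ba sigmaE mul1r pA_tens counit1B scale1r => ->.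
by sweq.
Qed.

Lemma counit_act b a : counit (b ▷ a) = counit b * counit a.
Proof.
(* Scalars are compared as multiples of a unit vector, whose counit is 1. *)
suff E : counit (b ▷ a) *: (1 : A) = (counit b * counit a) *: 1.
  by have := congr1 counit E; rewrite !counitZ counit1A !mulr1.
have E : ∑(c ⊗ d <- sigma (b ⊗ a)) counit c *: d = counit a *: b.
  exact: (set_conormal HS).
rewrite sigmaE in E.
step (counit (lhs (esym (counitr b)) ▷ a) *: (1 : A)).
by step (counit (lhs E) *: (1 : A)); rewrite ?counitZ ?[_ * counit b]mulrC; sweq.
Qed.

Lemma copMA a a' : cop (a * a') =
  ∑(a1 ⊗ a2 <- cop a) ∑(a1' ⊗ a2' <- cop a') (a1 * a1') ⊗ (a2 * a2').
Proof.
have -> : a * a' = pA ((a ⊗ 1) ⋆ (a' ⊗ 1)) by rewrite smul_aa pA_tens counit1B scale1r.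
by rewrite cop_pA; sweq.
Qed.

Lemma copMB b b' : cop (b * b') =
  ∑(b1 ⊗ b2 <- cop b) ∑(b1' ⊗ b2' <- cop b') (b1 * b1') ⊗ (b2 * b2').
Proof.
have E c : cop c = ∑(x ⊗ y <- Δ (1 ⊗ c)) pB x ⊗ pB y.
  by rewrite -cop_pB pB_tens counit1A scale1r.
rewrite E -smul_bb (E b) (E b') scomulM.
by sweq.
Qed.

(** The coproduct of (1 ⊗ b)(a ⊗ 1), projected to A ⊗ A. *)
Lemma cop_act b a : cop (b ▷ a) =
  ∑(b1 ⊗ b2 <- cop b) ∑(c ⊗ d <- rho b1) ∑(a1 ⊗ a2 <- cop a)
    (c ▷ a1) ⊗ (d * (b2 ▷ a2)).
Proof.
have -> : b ▷ a = pA ((1 ⊗ b) ⋆ (a ⊗ 1)) by rewrite pA_smul mul1r pA_tens counit1B scale1r.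
by rewrite cop_pA; sweq.
Qed.

Lemma rhoE b : rho b = ∑(x ⊗ y <- Δ (1 ⊗ b)) pB x ⊗ pA y.
Proof. by rewrite scomul_pBpA sw_tens //; solve_lin. Qed.

(** The coproduct of (1 ⊗ b)(1 ⊗ b'), projected to B ⊗ A. *)
Lemma rhoM b b' : rho (b * b') =
  ∑(b1 ⊗ b2 <- cop b) ∑(c ⊗ d <- rho b1) ∑(c' ⊗ d' <- rho b')
    (c * c') ⊗ (d * (b2 ▷ d')).
Proof.
rewrite rhoE -smul_bb.
by step (∑(b1 ⊗ b2 <- cop b) ∑(c ⊗ d <- rho b1) ∑(c' ⊗ d' <- rho (lhs (counitr b')))
    (c * c') ⊗ (d * (b2 ▷ d'))); sweq.
Qed.

(** The compatibility of action and coaction in a bicrossed product: both sides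
    are the projection to B ⊗ A of the coproduct of (1 ⊗ b)(a ⊗ 1), computed
    from the product or from [sigmaE]. *)
Lemma act_rho b a :
  ∑(b1 ⊗ b2 <- cop b) ∑(c ⊗ d <- rho b1) c ⊗ (d * (b2 ▷ a)) =
  ∑(b1 ⊗ b2 <- cop b) ∑(c ⊗ d <- rho b2) c ⊗ ((b1 ▷ a) * d).
Proof.
transitivity (∑(x ⊗ y <- Δ ((1 ⊗ b) ⋆ (a ⊗ 1))) pB x ⊗ pA y).
  symmetry.
  by step (∑(b1 ⊗ b2 <- cop b) ∑(c ⊗ d <- rho b1) c ⊗ (d * (b2 ▷ lhs (counitl a)))); sweq.
rewrite scomul_pBpA smul_ba sigmaE.
transitivity (∑(b1 ⊗ b2 <- cop b) tau ((b1 ▷ a) ⊗ b2)); first by sweq.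
by apply: sw_ext => b1 b2; rewrite tauE.
Qed.

Ltac head_rule t ::= lazymatch t with
  | smash_comul _ (_ ⊗ 1) => exact (scomul_l _)
  | smash_comul _ (1 ⊗ _) => exact (scomul_r _)
  | smash_comul _ (?a ⊗ ?b) => exact (scomul_tens a b)
  | smash_comul _ (smash_mul _ ?x ?y) => exact (scomulM x y)
  | cop 1 => first [exact comul1A | exact comul1B]
  | GRing.Linear.sort _ (?a ⊗ ?b) => exact (tauE a b)
  end.
(** The comodule coalgebra identity for B: coassociativity of H at 1 ⊗ b,
    projected to B ⊗ B ⊗ A. *)
Lemma rho_cop b :
  ∑(c ⊗ d <- rho b) ∑(c1 ⊗ c2 <- cop c) c1 ⊗ (c2 ⊗ d) =
  ∑(b1 ⊗ b2 <- cop b) ∑(c ⊗ d <- rho b1) ∑(c' ⊗ d' <- rho b2)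
    c ⊗ (c' ⊗ (d * d')).
Proof.
transitivity (∑(c ⊗ d <- ∑(x ⊗ y <- Δ (1 ⊗ b)) pB x ⊗ pA y)
   ∑(c1 ⊗ c2 <- cop c) c1 ⊗ (c2 ⊗ d)); first by rewrite -rhoE.
transitivity (∑(x ⊗ y <- Δ (1 ⊗ b)) ∑(x1 ⊗ x2 <- Δ x) pB x1 ⊗ (pB x2 ⊗ pA y)).
  rewrite sw_bind; last by solve_lin.
  apply: sw_ext => x y; rewrite sw_tens ?cop_pB; last by solve_lin.
  by sweq.
step (∑(x ⊗ y ⊗ z <- lhs (scoassoc (1 ⊗ b))) pB x ⊗ (pB y ⊗ pA z)).
by step (∑(b1 ⊗ b2 <- cop b) ∑(c ⊗ d <- rho b1)
  ∑(c' ⊗ d' <- rho (lhs (counitr b2))) c ⊗ (c' ⊗ (lhs (counitl d) * d'))); sweq.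
Qed.

Ltac head_rule t ::= lazymatch t with
  | Δ (?a ⊗ 1) => exact (scomul_l a)
  | Δ (1 ⊗ ?b) => exact (scomul_r b)
  | Δ (?a ⊗ ?b) => exact (scomul_tens a b)
  | Δ (?x ⋆ ?y) => exact (scomulM x y)
  | (?a ⊗ ?b) ⋆ (?a' ⊗ ?b') => exact (smulE a b a' b')
  | GRing.Linear.sort _ (?x ⊗ ?y) => first [exact (tauE x y) | exact (sigmaE x y)]
  | cop 1 => first [exact comul1A | exact comul1B]
  | cop (?x * ?y) => first [exact (copMA x y) | exact (copMB x y)]
  | cop (?b ▷ ?a) => exact (cop_act b a)
  | cop (pA ?h) => exact (cop_pA h)
  | cop (pB ?h) => exact (cop_pB h)
  | rho (?x * ?y) => exact (rhoM x y)
  end.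
Ltac base_simp := rewrite ?(mulZl, mulZr, tensZl, tensZr, actZl, actZr, pAZ,
  pBZ, smulZl, smulZr, counitZ, pA_tens, pB_tens, smash_counit_tens, scalerA,
  mulrA, mul1r, mulr1, scale1r, counitMA, counitMB, counit1A, counit1B,
  counit_act, pA_smul, pB_mul, act1, act_unit, actM, smulA, smul1, smulr1).
Ltac full_simp := base_simp; rewrite ?(smul_bb, smul_aa, smul_ab); base_simp.
Ltac leaf_simp ::= full_simp.
Ltac expand_rule pull := lazymatch goal with |- ?e = _ => lazymatch e with
  | context [act ?b (@GRing.mul ?R ?x ?y)] =>
      pull (act b (@GRing.mul R x y)) (act_mul b x y)
  | context [@smash_mul ?k ?A ?B ?s (@tens ?k1 ?U1 ?V1 ?a ?b)
                                    (@tens ?k2 ?U2 ?V2 ?a' ?b')] =>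
      pull (@smash_mul k A B s (@tens k1 U1 V1 a b) (@tens k2 U2 V2 a' b'))
           (smulE a b a' b')
  | context [@GRing.Linear.sort ?R ?U ?V ?s ?t (@tens ?k1 ?U1 ?V1 ?a ?b)] =>
      pull (@GRing.Linear.sort R U V s t (@tens k1 U1 V1 a b)) (tauE a b)
  end end.
Ltac leaf_rule pull ::= expand_rule pull.

(** pA is not multiplicative; the action measures the defect. *)
Lemma pA_mul x y : pA (x ⋆ y) = ∑(c ⊗ d <- Δ x) pA c * (pB d ▷ pA y).
Proof. by step (pA (lhs (esym (scomul_pApB x)) ⋆ y)); sweq. Qed.

Lemma pA_mul_b x b : pA (x ⋆ (1 ⊗ b)) = counit b *: pA x.
Proof.
rewrite pA_mul; symmetry.
by step (counit b *: pA (lhs (esym (scomul_pApB x)))); sweq.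
Qed.

Lemma counit_pB h : counit (pB h) = smash_counit h.
Proof.
have E : counit (pB h) *: (1 : A) = smash_counit h *: 1.
  by tensP h => a b; sweq.
by have := congr1 counit E; rewrite !counitZ counit1A !mulr1.
Qed.

Lemma counit_pA h : counit (pA h) = smash_counit h.
Proof.
have E : counit (pA h) *: (1 : A) = smash_counit h *: 1.
  by tensP h => a b; sweq.
by have := congr1 counit E; rewrite !counitZ counit1A !mulr1.
Qed.

Lemma tau_pApB h :
  ∑(c ⊗ d <- Δ h) tau (pA c ⊗ pB d) = ∑(c ⊗ d <- Δ h) pB c ⊗ pA d.
Proof.
rewrite scomul_pBpA; symmetry.
by step (∑(a ⊗ b <- lhs (esym (scomul_pApB h))) tau (a ⊗ b)); sweq.
Qed.

Lemma pA1 : pA (1 ⊗ 1 : A ⊗ B) = 1.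
Proof. by rewrite pA_tens counit1B scale1r. Qed.

Lemma pB1 : pB (1 ⊗ 1 : A ⊗ B) = 1.
Proof. by rewrite pB_tens counit1A scale1r. Qed.

(** * The identities in terms of the action and the coaction *)

Section Backward.
Variables (W : B ⊗ B) (X : A ⊗ B) (Y : B ⊗ A) (Z : A ⊗ A).

(** The i-th field is the i-th of the 19 identities.  The terms a_σ ε(b_σ) are
    written with the action and τ(1 ⊗ b) with the coaction; the full σ remains
    in D6 alone. *)
Record qt_data : Prop := QtData {
  D1 : forall a,
    ∑(z1 ⊗ z2 <- Z) ∑(x1' ⊗ x2' <- X) ∑(x1 ⊗ x2 <- X) ∑(w1 ⊗ w2 <- W)
    ∑(y1 ⊗ y2 <- Y) ∑(a1 ⊗ a2 <- cop a)
      (z1 * x1' * x1 * ((w1 * y1) ▷ a1)) ⊗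
      (z2 * (x2' ▷ y2) * ((x2 * w2) ▷ a2)) =
    ∑(z1 ⊗ z2 <- Z) ∑(a1 ⊗ a2 <- cop a) (a2 * z1) ⊗ (a1 * z2);
  D2 : forall a,
    ∑(x1 ⊗ x2 <- X) ∑(w1 ⊗ w2 <- W) (x1 * (w1 ▷ a)) ⊗ (x2 * w2) =
    ∑(x1 ⊗ x2 <- X) (a * x1) ⊗ x2;
  D3 : forall a,
    ∑(w1 ⊗ w2 <- W) ∑(y1 ⊗ y2 <- Y) (w1 * y1) ⊗ (y2 * (w2 ▷ a)) =
    ∑(y1 ⊗ y2 <- Y) y1 ⊗ (a * y2);
  D4 : forall b,
    ∑(z1 ⊗ z2 <- Z) z1 ⊗ (counit b *: z2) =
    ∑(z1 ⊗ z2 <- Z) ∑(b1 ⊗ b2 <- cop b) ∑(c ⊗ d <- rho b1)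
      (d * (b2 ▷ z1)) ⊗ (c ▷ z2);
  D5 : forall b,
    ∑(x1 ⊗ x2 <- X) x1 ⊗ (x2 * b) =
    ∑(x1 ⊗ x2 <- X) ∑(b1 ⊗ b2 <- cop b) ∑(c ⊗ d <- rho b1)
      (d * (b2 ▷ x1)) ⊗ (c * x2);
  D6 : forall b,
    ∑(w1 ⊗ w2 <- W) ∑(y1 ⊗ y2 <- Y) ∑(c ⊗ d <- rho b)
      (w1 * y1 * c) ⊗ (y2 * (w2 ▷ d)) =
    ∑(y1 ⊗ y2 <- Y) ∑(c ⊗ d <- sigma (b ⊗ y2)) (d * y1) ⊗ c;
  D7 : forall b,
    ∑(w1 ⊗ w2 <- W) ∑(b1 ⊗ b2 <- cop b) (w1 * b1) ⊗ (w2 * b2) =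
    ∑(w1 ⊗ w2 <- W) ∑(b1 ⊗ b2 <- cop b) (b2 * w1) ⊗ (b1 * w2);
  D8 :
    ∑(z1 ⊗ z2 <- Z) ∑(c ⊗ d <- cop z1) c ⊗ (d ⊗ z2) =
    ∑(z1 ⊗ z2 <- Z) ∑(x1 ⊗ x2 <- X) ∑(z1' ⊗ z2' <- Z)
      (z1 * x1) ⊗ (z1' ⊗ (z2 * (x2 ▷ z2')));
  D9 :
    ∑(x1 ⊗ x2 <- X) ∑(c ⊗ d <- cop x1) c ⊗ (d ⊗ x2) =
    ∑(x1 ⊗ x2 <- X) ∑(x1' ⊗ x2' <- X) x1 ⊗ (x1' ⊗ (x2 * x2'));
  D10 :
    ∑(y1 ⊗ y2 <- Y) ∑(z1 ⊗ z2 <- Z) ∑(x1 ⊗ x2 <- X)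
    ∑(c ⊗ d <- tau ((z1 * x1) ⊗ y1)) c ⊗ (d ⊗ (z2 * (x2 ▷ y2))) =
    ∑(w1 ⊗ w2 <- W) ∑(y1 ⊗ y2 <- Y) ∑(z1 ⊗ z2 <- Z)
      (w1 * y1) ⊗ (z1 ⊗ (y2 * (w2 ▷ z2)));
  D11 :
    ∑(w1 ⊗ w2 <- W) ∑(x1 ⊗ x2 <- X) ∑(c ⊗ d <- tau (x1 ⊗ w1))
      c ⊗ (d ⊗ (x2 * w2)) =
    ∑(w1 ⊗ w2 <- W) ∑(x1 ⊗ x2 <- X) w1 ⊗ (x1 ⊗ (w2 * x2));
  D12 :
    ∑(y1 ⊗ y2 <- Y) ∑(c ⊗ d <- cop y1) c ⊗ (d ⊗ y2) =
    ∑(w1 ⊗ w2 <- W) ∑(y1 ⊗ y2 <- Y) ∑(y1' ⊗ y2' <- Y)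
      (w1 * y1) ⊗ (y1' ⊗ (y2 * (w2 ▷ y2')));
  D13 :
    ∑(w1 ⊗ w2 <- W) ∑(c ⊗ d <- cop w1) c ⊗ (d ⊗ w2) =
    ∑(w1 ⊗ w2 <- W) ∑(w1' ⊗ w2' <- W) w1 ⊗ (w1' ⊗ (w2 * w2'));
  D14 :
    ∑(z1 ⊗ z2 <- Z) ∑(c ⊗ d <- cop z2) z1 ⊗ (c ⊗ d) =
    ∑(z1 ⊗ z2 <- Z) ∑(x1 ⊗ x2 <- X) ∑(z1' ⊗ z2' <- Z) ∑(y1 ⊗ y2 <- Y)
      (z1 * x1 * (y1 ▷ z1')) ⊗ (z2' ⊗ (z2 * (x2 ▷ y2)));
  D15 :
    ∑(z1 ⊗ z2 <- Z) ∑(x1 ⊗ x2 <- X) ∑(c ⊗ d <- tau (z2 ⊗ x2))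
      (z1 * x1) ⊗ (c ⊗ d) =
    ∑(z1 ⊗ z2 <- Z) ∑(x1 ⊗ x2 <- X) ∑(x1' ⊗ x2' <- X) ∑(y1 ⊗ y2 <- Y)
      (z1 * x1 * (y1 ▷ x1')) ⊗ (x2' ⊗ (z2 * (x2 ▷ y2)));
  D16 :
    ∑(x1 ⊗ x2 <- X) ∑(c ⊗ d <- cop x2) x1 ⊗ (c ⊗ d) =
    ∑(x1 ⊗ x2 <- X) ∑(x1' ⊗ x2' <- X) (x1 * x1') ⊗ (x2 ⊗ x2');
  D17 :
    ∑(y1 ⊗ y2 <- Y) ∑(c ⊗ d <- cop y2) y1 ⊗ (c ⊗ d) =
    ∑(y1 ⊗ y2 <- Y) ∑(y1' ⊗ y2' <- Y) (y1 * y1') ⊗ (y2' ⊗ y2);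
  D18 :
    ∑(w1 ⊗ w2 <- W) ∑(y1 ⊗ y2 <- Y) ∑(c ⊗ d <- tau (y2 ⊗ w2))
      (w1 * y1) ⊗ (c ⊗ d) =
    ∑(y1 ⊗ y2 <- Y) ∑(w1 ⊗ w2 <- W) (y1 * w1) ⊗ (w2 ⊗ y2);
  D19 :
    ∑(w1 ⊗ w2 <- W) ∑(c ⊗ d <- cop w2) w1 ⊗ (c ⊗ d) =
    ∑(w1 ⊗ w2 <- W) ∑(w1' ⊗ w2' <- W) (w1 * w1') ⊗ (w2' ⊗ w2)
}.

Hypothesis D : qt_data.

(** * From the identities to a quasitriangular structure *)

Definition elT : A ⊗ (A ⊗ B) :=
  ∑(z1 ⊗ z2 <- Z) ∑(x1 ⊗ x2 <- X) (z1 * x1) ⊗ (z2 ⊗ x2).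
Definition elU : B ⊗ (A ⊗ B) :=
  ∑(w1 ⊗ w2 <- W) ∑(y1 ⊗ y2 <- Y) (w1 * y1) ⊗ (y2 ⊗ w2).
Definition elV : (A ⊗ B) ⊗ B :=
  ∑(x1 ⊗ x2 <- X) ∑(w1 ⊗ w2 <- W) (x1 ⊗ w1) ⊗ (x2 * w2).
Definition elS : (A ⊗ B) ⊗ A :=
  ∑(z1 ⊗ z2 <- Z) ∑(x1 ⊗ x2 <- X) ∑(y1 ⊗ y2 <- Y)
    ((z1 * x1) ⊗ y1) ⊗ (z2 * (x2 ▷ y2)).
(** The element α, with σ written as the action. *)
Definition elR : (A ⊗ B) ⊗ (A ⊗ B) :=
  ∑(z1 ⊗ z2 <- Z) ∑(x1' ⊗ x2' <- X) ∑(x1 ⊗ x2 <- X)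
  ∑(w1 ⊗ w2 <- W) ∑(y1 ⊗ y2 <- Y)
    ((z1 * x1' * x1) ⊗ (w1 * y1)) ⊗ ((z2 * (x2' ▷ y2)) ⊗ (x2 * w2)).

(** D16 splits X2 into the copy acting on Y2 and the copy left in B. *)
Lemma elR_TU : elR =
  ∑(t1 ⊗ t2 <- elT) ∑(u1 ⊗ u2 <- elU) (t1 ⊗ u1) ⊗ (t2 ⋆ u2).
Proof.
rewrite /elT /elU; symmetry.
by step (∑(z1 ⊗ z2 <- Z) ∑(x1 ⊗ x2 ⊗ x3 <- lhs (D16 D)) ∑(w1 ⊗ w2 <- W)
  ∑(y1 ⊗ y2 <- Y) ((z1 * x1) ⊗ (w1 * y1)) ⊗ ((z2 * (x2 ▷ y2)) ⊗ (x3 * w2)));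
  rewrite /elR; sweq.
Qed.

(** D13 splits W1 into a copy acting on Z1 X1 and a copy left in B; D2 then
    moves Z1 X1 to the left of the outer X1. *)
Lemma elR_VS : elR =
  ∑(v1 ⊗ v2 <- elV) ∑(s1 ⊗ s2 <- elS) (v1 ⋆ s1) ⊗ (s2 ⊗ v2).
Proof.
rewrite /elV /elS; symmetry.
step (∑(x1 ⊗ x2 <- X) ∑(z1 ⊗ z2 <- Z) ∑(x1' ⊗ x2' <- X) ∑(y1 ⊗ y2 <- Y)
  ∑(w1 ⊗ w1' ⊗ w2 <- lhs (D13 D))
  ((x1 * (w1 ▷ (z1 * x1'))) ⊗ (w1' * y1)) ⊗ ((z2 * (x2' ▷ y2)) ⊗ (x2 * w2))).
by step (∑(z1 ⊗ z2 <- Z) ∑(x1' ⊗ x2' <- X) ∑(y1 ⊗ y2 <- Y)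
  ∑(w1' ⊗ w2' <- W) ∑(p ⊗ q <- lhs (D2 D (z1 * x1')))
  (p ⊗ (w1' * y1)) ⊗ ((z2 * (x2' ▷ y2)) ⊗ (q * w2')));
  rewrite /elR; sweq.
Qed.

(** D8 leaves a copy of X2 acting on the second Z2; on the other side D16
    produces the same action from the product of H. *)
Lemma cop_T : ∑(t1 ⊗ t2 <- elT) ∑(c ⊗ d <- cop t1) c ⊗ (d ⊗ t2) =
  ∑(t1 ⊗ t2 <- elT) ∑(t1' ⊗ t2' <- elT) t1 ⊗ (t1' ⊗ (t2 ⋆ t2')).
Proof.
rewrite /elT.
step (∑(z1 ⊗ z1' ⊗ z2 <- lhs (D8 D)) ∑(x1 ⊗ x1' ⊗ x2 <- lhs (D9 D))
  (z1 * x1) ⊗ ((z1' * x1') ⊗ (z2 ⊗ x2))).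
symmetry.
by step (∑(z1 ⊗ z2 <- Z) ∑(x1 ⊗ x2 ⊗ x3 <- lhs (D16 D))
  ∑(z1' ⊗ z2' <- Z) ∑(x1' ⊗ x2' <- X)
  (z1 * x1) ⊗ ((z1' * x1') ⊗ ((z2 * (x2 ▷ z2')) ⊗ (x3 * x2')))); sweq.
Qed.

(** As for [cop_T], with the copy of W2 left by D12 and the one split off by
    D19. *)
Lemma cop_U : ∑(u1 ⊗ u2 <- elU) ∑(c ⊗ d <- cop u1) c ⊗ (d ⊗ u2) =
  ∑(u1 ⊗ u2 <- elU) ∑(u1' ⊗ u2' <- elU) u1 ⊗ (u1' ⊗ (u2 ⋆ u2')).
Proof.
rewrite /elU.
step (∑(w1 ⊗ w1' ⊗ w2 <- lhs (D13 D)) ∑(y1 ⊗ y1' ⊗ y2 <- lhs (D12 D))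
  (w1 * y1) ⊗ ((w1' * y1') ⊗ (y2 ⊗ w2))).
symmetry.
by step (∑(y1 ⊗ y2 <- Y) ∑(w1 ⊗ w2 ⊗ w3 <- lhs (D19 D))
  ∑(w1' ⊗ w2' <- W) ∑(y1' ⊗ y2' <- Y)
  (w1 * y1) ⊗ ((w1' * y1') ⊗ ((y2 * (w2 ▷ y2')) ⊗ (w3 * w2')))); sweq.
Qed.

(** By [rhoM] the coaction on W1 Y1 leaves a copy of W1 acting on the coefficient
    of Y1; D11, D2 and D10 then move W, that coefficient and Y past X and Z. *)
Lemma TU_exch :
  ∑(t1 ⊗ t2 <- elT) ∑(u1 ⊗ u2 <- elU) ∑(c ⊗ d <- tau (t1 ⊗ u1))
    c ⊗ (d ⊗ (t2 ⋆ u2)) =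
  ∑(u1 ⊗ u2 <- elU) ∑(t1 ⊗ t2 <- elT) u1 ⊗ (t1 ⊗ (u2 ⋆ t2)).
Proof.
rewrite /elT /elU.
step (∑(z1 ⊗ z2 <- Z) ∑(w1 ⊗ w2 <- W) ∑(y1 ⊗ y2 <- Y)
  ∑(x1 ⊗ x2 ⊗ x3 <- lhs (D16 D)) ∑(c ⊗ d <- tau ((z1 * x1) ⊗ (w1 * y1)))
  c ⊗ (d ⊗ ((z2 * (x2 ▷ y2)) ⊗ (x3 * w2)))).
step (∑(z1 ⊗ z2 <- Z) ∑(x1' ⊗ x2' <- X) ∑(x1 ⊗ x2 <- X) ∑(y1 ⊗ y2 <- Y)
  ∑(w1 ⊗ w1' ⊗ w2 <- lhs (D13 D)) ∑(c ⊗ d <- rho w1) ∑(c' ⊗ d' <- rho y1)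
  (c * c') ⊗ ((z1 * x1' * x1 * d * (w1' ▷ d')) ⊗
              ((z2 * (x2' ▷ y2)) ⊗ (x2 * w2)))).
step (∑(z1 ⊗ z2 <- Z) ∑(x1' ⊗ x2' <- X) ∑(y1 ⊗ y2 <- Y) ∑(w1' ⊗ w2' <- W)
  ∑(c' ⊗ d' <- rho y1) ∑(p ⊗ q ⊗ r <- lhs (D11 D))
  (p * c') ⊗ ((z1 * x1' * q * (w1' ▷ d')) ⊗
              ((z2 * (x2' ▷ y2)) ⊗ (r * w2')))).
step (∑(z1 ⊗ z2 <- Z) ∑(x1' ⊗ x2' <- X) ∑(y1 ⊗ y2 <- Y) ∑(w1 ⊗ w2 <- W)
  ∑(c' ⊗ d' <- rho y1) ∑(p ⊗ q <- lhs (D2 D d'))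
  (w1 * c') ⊗ ((z1 * x1' * p) ⊗ ((z2 * (x2' ▷ y2)) ⊗ (w2 * q)))).
step (∑(w1 ⊗ w2 <- W) ∑(x1 ⊗ x2 <- X) ∑(p ⊗ q ⊗ r <- lhs (D10 D))
  (w1 * p) ⊗ ((q * x1) ⊗ (r ⊗ (w2 * x2)))).
symmetry.
by step (∑(w1 ⊗ w2 ⊗ w3 <- lhs (D19 D)) ∑(y1 ⊗ y2 <- Y) ∑(z1 ⊗ z2 <- Z)
  ∑(x1 ⊗ x2 <- X)
  (w1 * y1) ⊗ ((z1 * x1) ⊗ ((y2 * (w2 ▷ z2)) ⊗ (w3 * x2)))); sweq.
Qed.

Lemma qt2_R : ∑(r ⊗ s <- elR) ∑(c ⊗ d <- Δ r) c ⊗ (d ⊗ s) =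
  ∑(r ⊗ s <- elR) ∑(r' ⊗ s' <- elR) r ⊗ (r' ⊗ (s ⋆ s')).
Proof.
rewrite elR_TU.
step (∑(t1 ⊗ t1' ⊗ t2 <- lhs cop_T) ∑(u1 ⊗ u1' ⊗ u2 <- lhs cop_U)
  ∑(c ⊗ d <- tau (t1' ⊗ u1)) (t1 ⊗ c) ⊗ ((d ⊗ u1') ⊗ (t2 ⋆ u2))).
by step (∑(t1 ⊗ t2 <- elT) ∑(u1' ⊗ u2' <- elU) ∑(c ⊗ d ⊗ r <- lhs TU_exch)
  (t1 ⊗ c) ⊗ ((d ⊗ u1') ⊗ (t2 ⋆ r ⋆ u2'))); sweq.
Qed.

(** The first legs of two copies of V multiply as their X and W parts, since
    D2 commutes the action of W1 away. *)
Lemma cop_V : ∑(v1 ⊗ v2 <- elV) ∑(c ⊗ d <- cop v2) v1 ⊗ (c ⊗ d) =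
  ∑(v1 ⊗ v2 <- elV) ∑(v1' ⊗ v2' <- elV) (v1 ⋆ v1') ⊗ (v2' ⊗ v2).
Proof.
rewrite /elV.
step (∑(x1 ⊗ x2 ⊗ x2' <- lhs (D16 D)) ∑(w1 ⊗ w2 ⊗ w2' <- lhs (D19 D))
   (x1 ⊗ w1) ⊗ ((x2 * w2) ⊗ (x2' * w2'))).
symmetry.
step (∑(x1 ⊗ x2 <- X) ∑(x1' ⊗ x2' <- X) ∑(w1 ⊗ w1' ⊗ w2 <- lhs (D13 D))
  ∑(v1 ⊗ v2 <- W)
  ((x1 * (w1 ▷ x1')) ⊗ (w1' * v1)) ⊗ ((x2' * v2) ⊗ (x2 * w2))).
by step (∑(x1' ⊗ x2' <- X) ∑(p ⊗ q <- lhs (D2 D x1')) ∑(w1 ⊗ w2 <- W)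
  ∑(v1 ⊗ v2 <- W)
  (p ⊗ (w1 * v1)) ⊗ ((x2' * v2) ⊗ (q * w2))); sweq.
Qed.

(** A copy of Y1 split off by the coproduct becomes an independent copy of Y, at
    the cost of a further copy of X: the W produced by D12 is absorbed by D2. *)
Lemma act_splitY a :
  ∑(x1 ⊗ x2 <- X) ∑(y1 ⊗ y2 <- Y) ∑(c ⊗ d <- cop y1)
    (x1 * (c ▷ a)) ⊗ (d ⊗ (x2 ▷ y2)) =
  ∑(x1 ⊗ x2 <- X) ∑(y1' ⊗ y2' <- Y) ∑(x1' ⊗ x2' <- X) ∑(y1 ⊗ y2 <- Y)
    (x1 * (y1' ▷ a) * x1') ⊗ (y1 ⊗ ((x2 ▷ y2') * (x2' ▷ y2))).
Proof.
step (∑(x1 ⊗ x2 <- X) ∑(p ⊗ q ⊗ r <- lhs (D12 D))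
  (x1 * (p ▷ a)) ⊗ (q ⊗ (x2 ▷ r))).
step (∑(w1 ⊗ w2 <- W) ∑(y1 ⊗ y2 <- Y) ∑(y1' ⊗ y2' <- Y)
  ∑(x1 ⊗ x2 ⊗ x3 <- lhs (D16 D))
  (x1 * (w1 ▷ y1 ▷ a)) ⊗ (y1' ⊗ ((x2 ▷ y2) * ((x3 * w2) ▷ y2')))).
by step (∑(x1 ⊗ x2 <- X) ∑(y1 ⊗ y2 <- Y) ∑(y1' ⊗ y2' <- Y)
  ∑(p ⊗ q <- lhs (D2 D (y1 ▷ a)))
  (x1 * p) ⊗ (y1' ⊗ ((x2 ▷ y2) * (q ▷ y2')))); sweq.
Qed.

(** After τ has been expanded, [act_rho] exchanges the coefficient of the
    coaction on X2 with X2 ▷ Y2; this is what brings the coaction on X2 next to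
    Z2, where D15 applies.  D18 treats the coaction on W2 in between. *)
Lemma VS_exch :
  ∑(v1 ⊗ v2 <- elV) ∑(s1 ⊗ s2 <- elS) ∑(c ⊗ d <- tau (s2 ⊗ v2))
    (v1 ⋆ s1) ⊗ (c ⊗ d) =
  ∑(s1 ⊗ s2 <- elS) ∑(v1 ⊗ v2 <- elV) (s1 ⋆ v1) ⊗ (v2 ⊗ s2).
Proof.
step (∑(h ⊗ s ⊗ v <- lhs (esym elR_VS)) ∑(c ⊗ d <- tau (s ⊗ v)) h ⊗ (c ⊗ d)).
rewrite /elR.
(* The two copies of X are merged, so that act_rho can act on their
   common second leg. *)
step (∑(z1 ⊗ z2 <- Z) ∑(w1 ⊗ w2 <- W) ∑(y1 ⊗ y2 <- Y)
  ∑(p ⊗ q ⊗ r <- lhs (esym (D16 D))) ∑(c ⊗ d <- rho (r * w2))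
  ((z1 * p) ⊗ (w1 * y1)) ⊗ (c ⊗ (z2 * (q ▷ y2) * d))).
step (∑(z1 ⊗ z2 <- Z) ∑(w1 ⊗ w2 <- W) ∑(y1 ⊗ y2 <- Y) ∑(x1 ⊗ x2 <- X)
  ∑(q ⊗ r1 ⊗ r2 <- lhs (esym (coassoc x2)))
  ∑(c ⊗ d <- rho r1) ∑(c' ⊗ d' <- rho w2)
  ((z1 * x1) ⊗ (w1 * y1)) ⊗
    ((c * c') ⊗ (z2 * (q ▷ y2) * d * (r2 ▷ d')))).
step (∑(z1 ⊗ z2 <- Z) ∑(w1 ⊗ w2 <- W) ∑(y1 ⊗ y2 <- Y) ∑(x1 ⊗ x2 <- X)
  ∑(m ⊗ r2 <- cop x2) ∑(c ⊗ e <- lhs (esym (act_rho m y2)))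
  ∑(c' ⊗ d' <- rho w2)
  ((z1 * x1) ⊗ (w1 * y1)) ⊗ ((c * c') ⊗ (z2 * e * (r2 ▷ d')))).
step (∑(z1 ⊗ z2 <- Z) ∑(w1 ⊗ w2 <- W) ∑(y1 ⊗ y2 <- Y) ∑(x1 ⊗ x2 <- X)
  ∑(m1 ⊗ m2 ⊗ r2 <- lhs (coassoc x2))
  ∑(c ⊗ d <- rho m1) ∑(c' ⊗ d' <- rho w2)
  ((z1 * x1) ⊗ (w1 * y1)) ⊗
    ((c * c') ⊗ (z2 * d * (m2 ▷ y2) * (r2 ▷ d')))).
step (∑(z1 ⊗ z2 <- Z) ∑(w1 ⊗ w2 <- W) ∑(y1 ⊗ y2 <- Y)
  ∑(x1 ⊗ x2 ⊗ n <- lhs (D16 D)) ∑(c ⊗ d <- rho x2) ∑(c' ⊗ d' <- rho w2)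
  ((z1 * x1) ⊗ (w1 * y1)) ⊗ ((c * c') ⊗ (z2 * d * (n ▷ (y2 * d'))))).
step (∑(z1 ⊗ z2 <- Z) ∑(x1 ⊗ x2 <- X) ∑(x1' ⊗ x2' <- X)
  ∑(c ⊗ d <- rho x2) ∑(p ⊗ q ⊗ r <- lhs (D18 D))
  ((z1 * x1 * x1') ⊗ p) ⊗ ((c * q) ⊗ (z2 * d * (x2' ▷ r)))).
step (∑(y1 ⊗ y2 <- Y) ∑(w1 ⊗ w2 <- W) ∑(x1' ⊗ x2' <- X)
  ∑(p ⊗ q ⊗ r <- lhs (D15 D))
  ((p * x1') ⊗ (y1 * w1)) ⊗ ((q * w2) ⊗ (r * (x2' ▷ y2)))).
symmetry; unfold elS, elV.
by step (∑(z1 ⊗ z2 <- Z) ∑(x1' ⊗ x2' <- X) ∑(w1 ⊗ w2 <- W)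
  ∑(p ⊗ q ⊗ r <- lhs (act_splitY x1'))
  ((z1 * p) ⊗ (q * w1)) ⊗ ((x2' * w2) ⊗ (z2 * r))); sweq.
Qed.

(** The part of [cop_S] that concerns T only.  Applying D14 leaves X1 on the
    wrong side of Y1 ▷ Z1, and Z need not be invertible, so D15 cannot be used
    without the factor Z in front.  Trading X for X and W by D2 turns the
    expression into an instance of [VS_exch]. *)
Lemma cop_ZX :
  ∑(z1 ⊗ z2 <- Z) ∑(x1 ⊗ x2 <- X) ∑(p ⊗ q <- cop z2) ∑(c ⊗ d <- rho x2)
    (z1 * x1) ⊗ ((p ⊗ c) ⊗ (q * d)) =
  ∑(z1 ⊗ z2 <- Z) ∑(x1 ⊗ x2 <- X) ∑(y1 ⊗ y2 <- Y) ∑(z1' ⊗ z2' <- Z)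
  ∑(x1' ⊗ x2' <- X)
    (z1 * x1 * (y1 ▷ (z1' * x1'))) ⊗ ((z2' ⊗ x2') ⊗ (z2 * (x2 ▷ y2))).
Proof.
step (∑(x1 ⊗ x2 <- X) ∑(c ⊗ d <- rho x2) ∑(p ⊗ q ⊗ r <- lhs (D14 D))
  (p * x1) ⊗ ((q ⊗ c) ⊗ (r * d))).
step (∑(z1 ⊗ z2 <- Z) ∑(x1 ⊗ x2 <- X) ∑(z1' ⊗ z2' <- Z) ∑(y1 ⊗ y2 <- Y)
  ∑(p ⊗ q <- lhs (esym (D2 D (y1 ▷ z1')))) ∑(c ⊗ d <- rho q)
  (z1 * x1 * p) ⊗ ((z2' ⊗ c) ⊗ (z2 * (x2 ▷ y2) * d))).
have E := elR_VS; rewrite {1}/elR in E.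
step (∑(z1' ⊗ z2' <- Z) ∑(h ⊗ s ⊗ v <- lhs E) ∑(q ⊗ r <- tau (s ⊗ v))
  ∑(m ⊗ n <- h) (m * (n ▷ z1')) ⊗ ((z2' ⊗ q) ⊗ r)).
step (∑(z1' ⊗ z2' <- Z) ∑(h ⊗ q ⊗ r <- lhs VS_exch)
  ∑(m ⊗ n <- h) (m * (n ▷ z1')) ⊗ ((z2' ⊗ q) ⊗ r)).
unfold elS, elV.
by step (∑(z1 ⊗ z2 <- Z) ∑(x1 ⊗ x2 <- X) ∑(y1 ⊗ y2 <- Y) ∑(z1' ⊗ z2' <- Z)
  ∑(p ⊗ q <- lhs (D2 D z1'))
  (z1 * x1 * (y1 ▷ p)) ⊗ ((z2' ⊗ q) ⊗ (z2 * (x2 ▷ y2)))); sweq.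
Qed.

(** D16 and D17 split the second leg; [cop_ZX] and [act_splitY] match the two
    sides. *)
Lemma cop_S : ∑(s1 ⊗ s2 <- elS) ∑(c ⊗ d <- cop s2) s1 ⊗ (c ⊗ d) =
  ∑(s1 ⊗ s2 <- elS) ∑(s1' ⊗ s2' <- elS) (s1 ⋆ s1') ⊗ (s2' ⊗ s2).
Proof.
rewrite /elS.
step (∑(z1 ⊗ z2 <- Z) ∑(x1 ⊗ x2 ⊗ x3 <- lhs (D16 D))
  ∑(y1 ⊗ y2 ⊗ y3 <- lhs (D17 D)) ∑(p ⊗ q <- cop z2) ∑(c ⊗ d <- rho x2)
  ((z1 * x1) ⊗ y1) ⊗ ((p * (c ▷ y2)) ⊗ (q * d * (x3 ▷ y3)))).
step (∑(y1 ⊗ y2 <- Y) ∑(y1' ⊗ y2' <- Y) ∑(x1' ⊗ x2' <- X)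
  ∑(p ⊗ h ⊗ r <- lhs cop_ZX) ∑(m ⊗ n <- h)
  ((p * x1') ⊗ (y1 * y1')) ⊗ ((m * (n ▷ y2')) ⊗ (r * (x2' ▷ y2)))).
symmetry.
by step (∑(z1 ⊗ z2 <- Z) ∑(z1' ⊗ z2' <- Z) ∑(x1' ⊗ x2' <- X)
  ∑(y1' ⊗ y2' <- Y) ∑(p ⊗ q ⊗ r <- lhs (act_splitY (z1' * x1')))
  ((z1 * p) ⊗ (q * y1')) ⊗ ((z2' * (x2' ▷ y2')) ⊗ (z2 * r))); sweq.
Qed.

Lemma qt3_R : ∑(r ⊗ s <- elR) ∑(c ⊗ d <- Δ s) r ⊗ (c ⊗ d) =
  ∑(r ⊗ s <- elR) ∑(r' ⊗ s' <- elR) (r ⋆ r') ⊗ (s' ⊗ s).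
Proof.
rewrite elR_VS.
step (∑(v1 ⊗ v2 ⊗ v2' <- lhs cop_V) ∑(s1 ⊗ s2 ⊗ s2' <- lhs cop_S)
  ∑(c ⊗ d <- tau (s2' ⊗ v2)) (v1 ⋆ s1) ⊗ ((s2 ⊗ c) ⊗ (d ⊗ v2'))).
by step (∑(v1 ⊗ v2 <- elV) ∑(s1' ⊗ s2' <- elS) ∑(h ⊗ c ⊗ d <- lhs VS_exch)
  (v1 ⋆ h ⋆ s1') ⊗ ((s2' ⊗ c) ⊗ (d ⊗ v2))); sweq.
Qed.

(** The generator a ⊗ 1 in the second leg commutes with U. *)
Lemma U_comm a :
  ∑(u1 ⊗ u2 <- elU) u1 ⊗ (u2 ⋆ (a ⊗ 1)) =
  ∑(u1 ⊗ u2 <- elU) u1 ⊗ ((a ⊗ 1) ⋆ u2).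
Proof.
unfold elU.
step (∑(y1 ⊗ y2 <- Y) ∑(w1 ⊗ w2 ⊗ w3 <- lhs (D19 D))
  (w1 * y1) ⊗ ((y2 * (w2 ▷ a)) ⊗ w3)).
by step (∑(w1 ⊗ w2 <- W) ∑(p ⊗ q <- lhs (D3 D a)) (w1 * p) ⊗ (q ⊗ w2)); sweq.
Qed.

(** The remaining half of (QT4) for a ⊗ 1: moving it through the first leg of U
    makes U1 act on a1.  Three copies of X are needed: one acts on Y2, one on a2
    together with W2, and one stays in B and absorbs a copy of W by D2. *)
Lemma T_comm a :
  ∑(t1 ⊗ t2 <- elT) ∑(u1 ⊗ u2 <- elU) ∑(a1 ⊗ a2 <- cop a)
    (t1 * (u1 ▷ a1)) ⊗ (t2 ⋆ u2 ⋆ (a2 ⊗ 1)) =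
  ∑(t1 ⊗ t2 <- elT) ∑(a1 ⊗ a2 <- cop a) (a2 * t1) ⊗ ((a1 ⊗ 1) ⋆ t2).
Proof.
unfold elT, elU.
step (∑(z1 ⊗ z2 <- Z) ∑(y1 ⊗ y2 <- Y) ∑(a1 ⊗ a2 <- cop a)
  ∑(w1 ⊗ w2 ⊗ w3 <- lhs (D19 D)) ∑(x1 ⊗ x2 ⊗ n <- lhs (D16 D))
  ∑(x3 ⊗ x4 <- cop n)
  (z1 * x1 * ((w1 * y1) ▷ a1)) ⊗
    ((z2 * (x2 ▷ y2) * ((x3 * w2) ▷ a2)) ⊗ (x4 * w3))).
step (∑(z1 ⊗ z2 <- Z) ∑(y1 ⊗ y2 <- Y) ∑(a1 ⊗ a2 <- cop a)
  ∑(w1 ⊗ w2 <- W) ∑(w1' ⊗ w2' <- W) ∑(x1 ⊗ x2 <- X)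
  ∑(x1' ⊗ x3 ⊗ x4 <- lhs (D16 D))
  (z1 * x1 * x1' * ((w1 * w1' * y1) ▷ a1)) ⊗
    ((z2 * (x2 ▷ y2) * ((x3 * w2') ▷ a2)) ⊗ (x4 * w2))).
step (∑(z1 ⊗ z2 <- Z) ∑(y1 ⊗ y2 <- Y) ∑(a1 ⊗ a2 <- cop a)
  ∑(w1' ⊗ w2' <- W) ∑(x1 ⊗ x2 <- X) ∑(x1' ⊗ x2' <- X)
  ∑(p ⊗ q <- lhs (D2 D ((w1' * y1) ▷ a1)))
  (z1 * x1 * x1' * p) ⊗
    ((z2 * (x2 ▷ y2) * ((x2' * w2') ▷ a2)) ⊗ q)).
by step (∑(x1 ⊗ x2 <- X) ∑(p ⊗ q <- lhs (D1 D a)) (p * x1) ⊗ (q ⊗ x2)); sweq.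
Qed.

Lemma qt4_Ra a :
  ∑(r ⊗ s <- elR) ∑(a1 ⊗ a2 <- cop a) (r ⋆ (a1 ⊗ 1)) ⊗ (s ⋆ (a2 ⊗ 1)) =
  ∑(r ⊗ s <- elR) ∑(a1 ⊗ a2 <- cop a) ((a2 ⊗ 1) ⋆ r) ⊗ ((a1 ⊗ 1) ⋆ s).
Proof.
rewrite elR_TU.
step (∑(t1 ⊗ t2 <- elT) ∑(a1 ⊗ a2 <- cop a) ∑(u1 ⊗ u1' ⊗ u2 <- lhs cop_U)
  ((t1 * (u1 ▷ a1)) ⊗ u1') ⊗ (t2 ⋆ (u2 ⋆ (a2 ⊗ 1)))).
step (∑(t1 ⊗ t2 <- elT) ∑(a1 ⊗ a2 <- cop a) ∑(u1 ⊗ u2 <- elU)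
  ∑(u1' ⊗ m <- lhs (U_comm a2))
  ((t1 * (u1 ▷ a1)) ⊗ u1') ⊗ (t2 ⋆ u2 ⋆ m)).
by step (∑(u1' ⊗ u2' <- elU) ∑(p ⊗ q <- lhs (T_comm a))
  (p ⊗ u1') ⊗ (q ⋆ u2')); sweq.
Qed.

(** Z commutes with the flipped coproduct of 1 ⊗ b.  The four factors b1, ..., b4
    of the iterated coproduct are regrouped until D4 applies to the first two;
    [act_rho] first exchanges the coefficient of b2 with the action of b3. *)
Lemma Z_comm b :
  ∑(z1 ⊗ z2 <- Z) ∑(b1 ⊗ b2 <- cop b) ∑(c ⊗ d <- rho b1)
    ((d ⊗ b2) ⋆ (z1 ⊗ 1)) ⊗ ((1 ⊗ c) ⋆ (z2 ⊗ 1)) =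
  ∑(z1 ⊗ z2 <- Z) ∑(b1 ⊗ b2 <- cop b) ∑(c ⊗ d <- rho b1)
    ((z1 ⊗ 1) ⋆ (d ⊗ b2)) ⊗ ((z2 ⊗ 1) ⋆ (1 ⊗ c)).
Proof.
step (∑(z1 ⊗ z2 <- Z) ∑(b1 ⊗ b2 <- cop b) ∑(p ⊗ r <- cop b2)
  ∑(c1 ⊗ c2 ⊗ d <- lhs (rho_cop b1))
  ((d * (p ▷ z1)) ⊗ r) ⊗ ((c1 ▷ z2) ⊗ c2)).
step (∑(z1 ⊗ z2 <- Z) ∑(m ⊗ n ⊗ s <- lhs (coassoc b)) ∑(p ⊗ r <- cop s)
  ∑(c ⊗ d <- rho m) ∑(c' ⊗ d' <- rho n)
  ((d * d' * (p ▷ z1)) ⊗ r) ⊗ ((c ▷ z2) ⊗ c')).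
step (∑(z1 ⊗ z2 <- Z) ∑(m ⊗ t <- cop b)
  ∑(n ⊗ p ⊗ r <- lhs (esym (coassoc t)))
  ∑(c ⊗ d <- rho m) ∑(c' ⊗ d' <- rho n)
  ((d * d' * (p ▷ z1)) ⊗ r) ⊗ ((c ▷ z2) ⊗ c')).
step (∑(z1 ⊗ z2 <- Z) ∑(m ⊗ t <- cop b) ∑(g ⊗ r <- cop t)
  ∑(c ⊗ d <- rho m) ∑(c' ⊗ e <- lhs (act_rho g z1))
  ((d * e) ⊗ r) ⊗ ((c ▷ z2) ⊗ c')).
step (∑(z1 ⊗ z2 <- Z) ∑(m ⊗ t <- cop b) ∑(n ⊗ p ⊗ r <- lhs (coassoc t))
  ∑(c ⊗ d <- rho m) ∑(c' ⊗ d' <- rho p)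
  ((d * (n ▷ z1) * d') ⊗ r) ⊗ ((c ▷ z2) ⊗ c')).
step (∑(z1 ⊗ z2 <- Z) ∑(m ⊗ n ⊗ s <- lhs (esym (coassoc b)))
  ∑(p ⊗ r <- cop s) ∑(c ⊗ d <- rho m) ∑(c' ⊗ d' <- rho p)
  ((d * (n ▷ z1) * d') ⊗ r) ⊗ ((c ▷ z2) ⊗ c')).
step (∑(g ⊗ s <- cop b) ∑(p ⊗ r <- cop s) ∑(c' ⊗ d' <- rho p)
  ∑(z1 ⊗ z2 <- lhs (esym (D4 D g))) ((z1 * d') ⊗ r) ⊗ (z2 ⊗ c')).
symmetry.
by step (∑(z1 ⊗ z2 <- Z) ∑(p ⊗ r <- cop (lhs (esym (counitl b))))
  ∑(c' ⊗ d' <- rho p) ((z1 * d') ⊗ r) ⊗ (z2 ⊗ c')); sweq.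
Qed.

(** The factor X turns the flipped coproduct of 1 ⊗ b into the flipped
    coproduct of B. *)
Lemma X_comm b :
  ∑(x1 ⊗ x2 <- X) ∑(b1 ⊗ b2 <- cop b) ∑(c ⊗ d <- rho b1)
    ((d ⊗ b2) ⋆ (x1 ⊗ 1)) ⊗ ((1 ⊗ c) ⋆ (1 ⊗ x2)) =
  ∑(x1 ⊗ x2 <- X) ∑(b1 ⊗ b2 <- cop b)
    ((x1 ⊗ 1) ⋆ (1 ⊗ b2)) ⊗ ((1 ⊗ x2) ⋆ (1 ⊗ b1)).
Proof.
symmetry.
step (∑(b1 ⊗ b2 <- cop b) ∑(x1 ⊗ x2 <- lhs (D5 D b1))
  (x1 ⊗ b2) ⊗ ((1 : A) ⊗ x2)).
symmetry.
by step (∑(x1 ⊗ x2 <- X) ∑(p ⊗ q ⊗ r <- lhs (esym (coassoc b)))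
  ∑(c ⊗ d <- rho p) ((d * (q ▷ x1)) ⊗ r) ⊗ ((1 : A) ⊗ (c * x2))); sweq.
Qed.

(** The factor U turns the flipped coproduct of B into the coproduct of 1 ⊗ b
    in H. *)
Lemma U_comm_b b :
  ∑(u1 ⊗ u2 <- elU) ∑(b1 ⊗ b2 <- cop b)
    ((1 ⊗ b2) ⋆ (1 ⊗ u1)) ⊗ ((1 ⊗ b1) ⋆ u2) =
  ∑(u1 ⊗ u2 <- elU) ∑(b1 ⊗ b2 <- cop b) ∑(c ⊗ d <- rho b1)
    ((1 ⊗ u1) ⋆ (1 ⊗ c)) ⊗ (u2 ⋆ (d ⊗ b2)).
Proof.
unfold elU.
step (∑(y1 ⊗ y2 <- Y) ∑(w1 ⊗ w2 <- W) ∑(p ⊗ q ⊗ r <- lhs (coassoc b))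
  ((1 : A) ⊗ (r * w1 * y1)) ⊗ ((p ▷ y2) ⊗ (q * w2))).
step (∑(y1 ⊗ y2 <- Y) ∑(b1 ⊗ n <- cop b) ∑(p ⊗ q <- lhs (esym (D7 D n)))
  ((1 : A) ⊗ (p * y1)) ⊗ ((b1 ▷ y2) ⊗ q)).
step (∑(y1 ⊗ y2 <- Y) ∑(w1 ⊗ w2 <- W) ∑(p ⊗ q ⊗ r <- lhs (esym (coassoc b)))
  ((1 : A) ⊗ (w1 * q * y1)) ⊗ ((p ▷ y2) ⊗ (w2 * r))).
step (∑(w1 ⊗ w2 <- W) ∑(g ⊗ r <- cop b) ∑(p ⊗ q <- lhs (esym (D6 D g)))
  ((1 : A) ⊗ (w1 * p)) ⊗ (q ⊗ (w2 * r))).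
symmetry.
by step (∑(y1 ⊗ y2 <- Y) ∑(w1 ⊗ w2 ⊗ w3 <- lhs (D19 D))
  ∑(b1 ⊗ b2 <- cop b) ∑(c ⊗ d <- rho b1)
  ((1 : A) ⊗ (w1 * y1 * c)) ⊗ ((y2 * (w2 ▷ d)) ⊗ (w3 * b2))); sweq.
Qed.

Lemma elR_ZXU : elR =
  ∑(z1 ⊗ z2 <- Z) ∑(x1 ⊗ x2 <- X) ∑(u1 ⊗ u2 <- elU)
    ((z1 ⊗ 1) ⋆ (x1 ⊗ 1) ⋆ (1 ⊗ u1)) ⊗ ((z2 ⊗ 1) ⋆ (1 ⊗ x2) ⋆ u2).
Proof.
rewrite elR_TU /elT; symmetry.
step (∑(z1 ⊗ z2 <- Z) ∑(x1 ⊗ x2 <- X) ∑(u1 ⊗ u2 <- elU)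
    ((z1 * x1) ⊗ u1) ⊗ ((z2 ⊗ x2) ⋆ u2)).
by sweq.
Qed.

(** Products are left unexpanded here: [qt4_Rb] only moves a factor through a
    product. *)
Ltac leaf_rule pull ::= fail.
Ltac leaf_simp ::= base_simp.

Lemma qt4_Rb b :
  ∑(r ⊗ s <- elR) ∑(b1 ⊗ b2 <- cop b) ∑(c ⊗ d <- rho b1)
    (r ⋆ (1 ⊗ c)) ⊗ (s ⋆ (d ⊗ b2)) =
  ∑(r ⊗ s <- elR) ∑(b1 ⊗ b2 <- cop b) ∑(c ⊗ d <- rho b1)
    ((d ⊗ b2) ⋆ r) ⊗ ((1 ⊗ c) ⋆ s).
Proof.
rewrite elR_ZXU; symmetry.
step (∑(x1 ⊗ x2 <- X) ∑(u1 ⊗ u2 <- elU) ∑(p ⊗ q <- lhs (Z_comm b))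
  (p ⋆ (x1 ⊗ 1) ⋆ (1 ⊗ u1)) ⊗ (q ⋆ (1 ⊗ x2) ⋆ u2)).
step (∑(z1 ⊗ z2 <- Z) ∑(u1 ⊗ u2 <- elU) ∑(p ⊗ q <- lhs (X_comm b))
  ((z1 ⊗ 1) ⋆ p ⋆ (1 ⊗ u1)) ⊗ ((z2 ⊗ 1) ⋆ q ⋆ u2)).
by step (∑(z1 ⊗ z2 <- Z) ∑(x1 ⊗ x2 <- X) ∑(p ⊗ q <- lhs (U_comm_b b))
  ((z1 ⊗ 1) ⋆ (x1 ⊗ 1) ⋆ p) ⊗ ((z2 ⊗ 1) ⋆ (1 ⊗ x2) ⋆ q)); sweq.
Qed.

Lemma qt4_R h :
  ∑(r ⊗ s <- elR) ∑(c ⊗ d <- Δ h) (r ⋆ c) ⊗ (s ⋆ d) =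
  ∑(r ⊗ s <- elR) ∑(c ⊗ d <- Δ h) (d ⋆ r) ⊗ (c ⋆ s).
Proof.
tensP h => a b.
rewrite -smul_ab.
step (∑(r ⊗ s <- lhs (qt4_Ra a)) ∑(b1 ⊗ b2 <- cop b) ∑(c ⊗ d <- rho b1)
  (r ⋆ (1 ⊗ c)) ⊗ (s ⋆ (d ⊗ b2))).
by step (∑(r ⊗ s <- lhs (qt4_Rb b)) ∑(a1 ⊗ a2 <- cop a)
  ((a2 ⊗ 1) ⋆ r) ⊗ ((a1 ⊗ 1) ⋆ s)); sweq.
Qed.

Ltac leaf_rule pull ::= expand_rule pull.

Hypotheses (nW : normalized W) (nX : normalized X) (nY : normalized Y)
  (nZ : normalized Z).

Lemma qt1l_R : ∑(r ⊗ s <- elR) @smash_counit _ A B r *: s = 1 ⊗ 1.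
Proof.
have W1 : ∑(w1 ⊗ w2 <- W) counit w1 *: w2 = 1 by exact: (proj1 nW).
have X1 : ∑(x1 ⊗ x2 <- X) counit x1 *: x2 = 1 by exact: (proj1 nX).
have Y1 : ∑(y1 ⊗ y2 <- Y) counit y1 *: y2 = 1 by exact: (proj1 nY).
have Z1 : ∑(z1 ⊗ z2 <- Z) counit z1 *: z2 = 1 by exact: (proj1 nZ).
unfold elR.
(* A sum occurring twice would not be linear, so the two copies of X are
   collapsed one after the other. *)
step (∑(x1 ⊗ x2 <- X) ∑(w1 ⊗ w2 <- W) (counit x1 * counit w1) *:
  ((lhs Z1 * (lhs X1 ▷ lhs Y1)) ⊗ (x2 * w2))).
by step ((1 : A) ⊗ (lhs X1 * lhs W1)); sweq.
Qed.

Lemma qt1r_R : ∑(r ⊗ s <- elR) @smash_counit _ A B s *: r = 1 ⊗ 1.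
Proof.
have W1 : ∑(w1 ⊗ w2 <- W) counit w2 *: w1 = 1 by exact: (proj2 nW).
have X1 : ∑(x1 ⊗ x2 <- X) counit x2 *: x1 = 1 by exact: (proj2 nX).
have Y1 : ∑(y1 ⊗ y2 <- Y) counit y2 *: y1 = 1 by exact: (proj2 nY).
have Z1 : ∑(z1 ⊗ z2 <- Z) counit z2 *: z1 = 1 by exact: (proj2 nZ).
unfold elR.
step (∑(x1 ⊗ x2 <- X) counit x2 *:
  ((lhs Z1 * lhs X1 * x1) ⊗ (lhs W1 * lhs Y1))).
by step (lhs X1 ⊗ (1 : B)); sweq.
Qed.
End Backward.

Ltac leaf_simp ::= full_simp; rewrite ?(pA_mul_b, counit_pA, counit_pB); base_simp.
Ltac leaf_rule pull ::= first [ expand_rule pull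
  | lazymatch goal with |- ?e = _ => lazymatch e with
    context [pA (@smash_mul ?k ?A ?B ?s ?x ?y)] =>
      pull (pA (@smash_mul k A B s x y)) (pA_mul x y) end end ].

(** * From a quasitriangular structure to the identities *)

Section Forward.
Variable R : (A ⊗ B) ⊗ (A ⊗ B).
Hypothesis R1 : ∑(r ⊗ s <- R) @smash_counit _ A B r *: s = 1 ⊗ 1.
Hypothesis R1' : ∑(r ⊗ s <- R) @smash_counit _ A B s *: r = 1 ⊗ 1.
Hypothesis R2 : ∑(r ⊗ s <- R) ∑(c ⊗ d <- Δ r) c ⊗ (d ⊗ s) =
  ∑(r ⊗ s <- R) ∑(r' ⊗ s' <- R) r ⊗ (r' ⊗ (s ⋆ s')).
Hypothesis R3 : ∑(r ⊗ s <- R) ∑(c ⊗ d <- Δ s) r ⊗ (c ⊗ d) =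
  ∑(r ⊗ s <- R) ∑(r' ⊗ s' <- R) (r ⋆ r') ⊗ (s' ⊗ s).
Hypothesis R4 : forall h, ∑(r ⊗ s <- R) ∑(c ⊗ d <- Δ h) (r ⋆ c) ⊗ (s ⋆ d) =
  ∑(r ⊗ s <- R) ∑(c ⊗ d <- Δ h) (d ⋆ r) ⊗ (c ⋆ s).

Definition projW : B ⊗ B := ∑(r ⊗ s <- R) pB r ⊗ pB s.
Definition projX : A ⊗ B := ∑(r ⊗ s <- R) pA r ⊗ pB s.
Definition projY : B ⊗ A := ∑(r ⊗ s <- R) pB r ⊗ pA s.
Definition projZ : A ⊗ A := ∑(r ⊗ s <- R) pA r ⊗ pA s.

(** (QT4) at a ⊗ 1, projected to A ⊗ B; (QT2) rewrites R1 (a ⊗ 1) as the action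
    of a second copy of R.  This is D2, with X and W written as projections. *)
Lemma AB_comm a :
  ∑(r ⊗ s <- R) ∑(r' ⊗ s' <- R) (pA r * (pB r' ▷ a)) ⊗ (pB s * pB s') =
  ∑(r ⊗ s <- R) (a * pA r) ⊗ pB s.
Proof.
step (∑(r ⊗ r' ⊗ s <- lhs (esym R2)) (pA r * (pB r' ▷ a)) ⊗ pB s).
step (∑(r ⊗ s <- R) ∑(c ⊗ d <- Δ r)
  (pA c * (pB d ▷ lhs (esym (counitr a)))) ⊗ pB s).
step (∑(p ⊗ q <- lhs (R4 (a ⊗ 1))) pA p ⊗ pB q).
symmetry.
by step (∑(r ⊗ s <- R) (lhs (esym (counitl a)) * pA r) ⊗ pB s); sweq.
Qed.

(** The analogue of [AB_comm] for B ⊗ A, with (QT3) in place of (QT2): D3. *)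
Lemma BA_comm a :
  ∑(r ⊗ s <- R) ∑(r' ⊗ s' <- R) (pB r * pB r') ⊗ (pA s' * (pB s ▷ a)) =
  ∑(r ⊗ s <- R) pB r ⊗ (a * pA s).
Proof.
step (∑(r ⊗ c ⊗ d <- lhs (esym R3)) pB r ⊗ (pA c * (pB d ▷ a))).
step (∑(r ⊗ s <- R) ∑(c ⊗ d <- Δ s)
  pB r ⊗ (pA c * (pB d ▷ lhs (esym (counitl a))))).
step (∑(p ⊗ q <- lhs (R4 (a ⊗ 1))) pB p ⊗ pA q).
symmetry.
by step (∑(r ⊗ s <- R) pB r ⊗ (lhs (esym (counitr a)) * pA s)); sweq.
Qed.

(** By [pA_mul], multiplying on the right before projecting makes pB of the
    second half of r act; [AB_comm] removes that action. *)
Lemma pA_mull_pB g :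
  ∑(r ⊗ s <- R) pA (r ⋆ g) ⊗ pB s = ∑(r ⊗ s <- R) (pA g * pA r) ⊗ pB s.
Proof.
step (∑(c ⊗ d ⊗ s <- lhs R2) (pA c * (pB d ▷ pA g)) ⊗ pB s).
by step (∑(p ⊗ q <- lhs (AB_comm (pA g))) p ⊗ q); sweq.
Qed.

Lemma pA_mulr_pA h :
  ∑(r ⊗ s <- R) pA r ⊗ pA (s ⋆ h) =
  ∑(r ⊗ s <- R) ∑(r' ⊗ s' <- R)
    (pA r' * pA r) ⊗ (pA s' * (pB s ▷ pA h)).
Proof.
step (∑(r ⊗ c ⊗ d <- lhs R3) pA r ⊗ (pA c * (pB d ▷ pA h))).
by step (∑(r' ⊗ s' <- R) ∑(p ⊗ q <- lhs (pA_mull_pB r'))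
  p ⊗ (pA s' * (q ▷ pA h))); sweq.
Qed.

Lemma pB_mulr_pA h :
  ∑(r ⊗ s <- R) pB r ⊗ pA (s ⋆ h) =
  ∑(r ⊗ s <- R) ∑(r' ⊗ s' <- R)
    (pB r * pB r') ⊗ (pA s' * (pB s ▷ pA h)).
Proof.
by step (∑(r ⊗ c ⊗ d <- lhs R3) pB r ⊗ (pA c * (pB d ▷ pA h))); sweq.
Qed.

Lemma pA_mull_pA h :
  ∑(r ⊗ s <- R) pA (r ⋆ h) ⊗ pA s =
  ∑(z1 ⊗ z2 <- projZ) ∑(x1 ⊗ x2 <- projX) ∑(y1 ⊗ y2 <- projY)
    (z1 * x1 * (y1 ▷ pA h)) ⊗ (z2 * (x2 ▷ y2)).
Proof.
unfold projZ, projX, projY.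
step (∑(c ⊗ d ⊗ s <- lhs R2) (pA c * (pB d ▷ pA h)) ⊗ pA s).
by step (∑(r' ⊗ s' <- R) ∑(p ⊗ q <- lhs (pA_mulr_pA s'))
  (p * (pB r' ▷ pA h)) ⊗ q); sweq.
Qed.

(** Both legs are split by the reconstruction formula.  (QT2) and (QT3) turn the
    four halves into four copies of R, and each copy whose first leg is projected
    to A and multiplied by another one is moved behind it by [pA_mull_pB]. *)
Lemma R_eq : R = elR projW projX projY projZ.
Proof.
rewrite /elR /projW /projX /projY /projZ -[LHS]sw_tensE.
step (∑(r ⊗ s <- R)
  lhs (esym (scomul_pApB r)) ⊗ lhs (esym (scomul_pApB s))).
step (∑(c ⊗ d ⊗ s <- lhs R2) ∑(e ⊗ f <- Δ s)
  (pA c ⊗ pB d) ⊗ (pA e ⊗ pB f)).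
step (∑(r ⊗ c ⊗ d <- lhs R3) ∑(r' ⊗ c' ⊗ d' <- lhs R3)
  (pA r ⊗ pB r') ⊗ (pA (c ⋆ c') ⊗ (pB d * pB d'))).
step (∑(t ⊗ u <- R) ∑(r' ⊗ s' <- R) ∑(t' ⊗ u' <- R)
  ∑(p ⊗ q <- lhs (pA_mull_pB t))
  (p ⊗ (pB r' * pB t')) ⊗ (pA (u ⋆ u') ⊗ (q * pB s'))).
step (∑(r ⊗ s <- R) ∑(r' ⊗ s' <- R) ∑(t' ⊗ u' <- R)
  ∑(t ⊗ c ⊗ d <- lhs R3)
  ((pA t * pA r) ⊗ (pB r' * pB t')) ⊗
    ((pA c * (pB d ▷ pA u')) ⊗ (pB s * pB s'))).
by step (∑(r ⊗ s <- R) ∑(r' ⊗ s' <- R) ∑(t' ⊗ u' <- R)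
  ∑(z ⊗ z' <- R) ∑(p ⊗ q <- lhs (pA_mull_pB z))
  ((p * pA r) ⊗ (pB r' * pB t')) ⊗
    ((pA z' * (q ▷ pA u')) ⊗ (pB s * pB s'))); sweq.
Qed.

Lemma norm_projW : normalized projW.
Proof.
split.
  suff E : ∑(t1 ⊗ t2 <- projW) counit t1 *: t2 = pB (1 ⊗ 1 : A ⊗ B).
    exact: (etrans E pB1).
  by rewrite /projW; symmetry; step (pB (lhs (esym R1))); sweq.
suff E : ∑(t1 ⊗ t2 <- projW) counit t2 *: t1 = pB (1 ⊗ 1 : A ⊗ B).
  exact: (etrans E pB1).
by rewrite /projW; symmetry; step (pB (lhs (esym R1'))); sweq.
Qed.

Lemma norm_projX : normalized projX.
Proof.
split.
  suff E : ∑(t1 ⊗ t2 <- projX) counit t1 *: t2 = pB (1 ⊗ 1 : A ⊗ B).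
    exact: (etrans E pB1).
  by rewrite /projX; symmetry; step (pB (lhs (esym R1))); sweq.
suff E : ∑(t1 ⊗ t2 <- projX) counit t2 *: t1 = pA (1 ⊗ 1 : A ⊗ B).
  exact: (etrans E pA1).
by rewrite /projX; symmetry; step (pA (lhs (esym R1'))); sweq.
Qed.

Lemma norm_projY : normalized projY.
Proof.
split.
  suff E : ∑(t1 ⊗ t2 <- projY) counit t1 *: t2 = pA (1 ⊗ 1 : A ⊗ B).
    exact: (etrans E pA1).
  by rewrite /projY; symmetry; step (pA (lhs (esym R1))); sweq.
suff E : ∑(t1 ⊗ t2 <- projY) counit t2 *: t1 = pB (1 ⊗ 1 : A ⊗ B).
  exact: (etrans E pB1).
by rewrite /projY; symmetry; step (pB (lhs (esym R1'))); sweq.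
Qed.

Lemma norm_projZ : normalized projZ.
Proof.
split.
  suff E : ∑(t1 ⊗ t2 <- projZ) counit t1 *: t2 = pA (1 ⊗ 1 : A ⊗ B).
    exact: (etrans E pA1).
  by rewrite /projZ; symmetry; step (pA (lhs (esym R1))); sweq.
suff E : ∑(t1 ⊗ t2 <- projZ) counit t2 *: t1 = pA (1 ⊗ 1 : A ⊗ B).
  exact: (etrans E pA1).
by rewrite /projZ; symmetry; step (pA (lhs (esym R1'))); sweq.
Qed.

Lemma qt_data_R : qt_data projW projX projY projZ.
Proof.
have RE := R_eq; rewrite /elR in RE.
split; try move=> a.
- step (∑(r ⊗ s <- lhs (esym RE)) ∑(a1 ⊗ a2 <- cop a)
    pA (r ⋆ (a1 ⊗ 1)) ⊗ pA (s ⋆ (a2 ⊗ 1))).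
  step (∑(p ⊗ q <- lhs (R4 (a ⊗ 1))) pA p ⊗ pA q).
  by unfold projZ; sweq.
- unfold projX, projW.
  by step (∑(p ⊗ q <- lhs (AB_comm a)) p ⊗ q); sweq.
- unfold projY, projW.
  by step (∑(p ⊗ q <- lhs (BA_comm a)) p ⊗ q); sweq.
- rename a into b; unfold projZ; symmetry.
  step (∑(p ⊗ q <- lhs (esym (R4 (1 ⊗ b)))) pA p ⊗ pA q).
  step (∑(r ⊗ s <- R) ∑(b1 ⊗ b2 <- cop b)
    pA r ⊗ pA (s ⋆ (lhs (rho_counitl b1) ⊗ b2))).
  by step (∑(r ⊗ s <- R) pA r ⊗ (counit (lhs (counitl b)) *: pA s)); sweq.
- rename a into b; unfold projX; symmetry.
  step (∑(p ⊗ q <- lhs (esym (R4 (1 ⊗ b)))) pA p ⊗ pB q).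
  step (∑(r ⊗ s <- R) ∑(b1 ⊗ b2 <- cop b)
    pA r ⊗ (pB s * (counit (lhs (rho_counitr b1)) *: b2))).
  by step (∑(r ⊗ s <- R) pA r ⊗ (pB s * lhs (counitl b))); sweq.
- rename a into b; unfold projW, projY.
  step (∑(c ⊗ d <- rho b) ∑(r ⊗ e ⊗ f <- lhs (esym R3))
    (pB r * c) ⊗ (pA e * (pB f ▷ d))).
  step (∑(r ⊗ s <- R) ∑(e ⊗ f <- Δ s)
    ∑(c ⊗ d <- rho (lhs (esym (counitr b))))
    (pB r * c) ⊗ (pA e * (pB f ▷ d))).
  step (∑(p ⊗ q <- lhs (R4 (1 ⊗ b))) pB p ⊗ pA q).
  by step (∑(r ⊗ s <- R) ∑(b1 ⊗ b2 <- cop b)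
    (b2 * pB r) ⊗ (lhs (rho_counitr b1) ▷ pA s)); sweq.
- rename a into b; unfold projW.
  step (∑(r ⊗ s <- R) ∑(b1 ⊗ b2 <- cop b)
    (pB r * lhs (esym (rho_counitr b1))) ⊗ (pB s * b2)).
  step (∑(p ⊗ q <- lhs (R4 (1 ⊗ b))) pB p ⊗ pB q).
  by step (∑(r ⊗ s <- R) ∑(b1 ⊗ b2 <- cop b)
    (b2 * pB r) ⊗ (lhs (rho_counitr b1) * pB s)); sweq.
- unfold projZ, projX.
  step (∑(c ⊗ d ⊗ s <- lhs R2) pA c ⊗ (pA d ⊗ pA s)).
  by step (∑(r' ⊗ s' <- R) ∑(p ⊗ q <- lhs (pA_mulr_pA s'))
    p ⊗ (pA r' ⊗ q)); sweq.
- unfold projX.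
  by step (∑(c ⊗ d ⊗ s <- lhs R2) pA c ⊗ (pA d ⊗ pB s)); sweq.
- unfold projX, projY, projZ, projW.
  step (∑(r' ⊗ s' <- R) ∑(p ⊗ q <- lhs (esym (pA_mulr_pA s')))
    ∑(c ⊗ d <- tau (p ⊗ pB r')) c ⊗ (d ⊗ q)).
  step (∑(r ⊗ r' ⊗ s <- lhs (esym R2)) ∑(c ⊗ d <- tau (pA r ⊗ pB r'))
    c ⊗ (d ⊗ pA s)).
  step (∑(r ⊗ s <- R) ∑(c ⊗ d <- lhs (tau_pApB r)) c ⊗ (d ⊗ pA s)).
  step (∑(c ⊗ d ⊗ s <- lhs R2) pB c ⊗ (pA d ⊗ pA s)).
  by step (∑(r' ⊗ s' <- R) ∑(p ⊗ q <- lhs (pB_mulr_pA s'))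
    p ⊗ (pA r' ⊗ q)); sweq.
- unfold projX, projW.
  step (∑(r ⊗ r' ⊗ s <- lhs (esym R2)) ∑(c ⊗ d <- tau (pA r ⊗ pB r'))
    c ⊗ (d ⊗ pB s)).
  step (∑(r ⊗ s <- R) ∑(c ⊗ d <- lhs (tau_pApB r)) c ⊗ (d ⊗ pB s)).
  by step (∑(c ⊗ d ⊗ s <- lhs R2) pB c ⊗ (pA d ⊗ pB s)); sweq.
- unfold projY, projW.
  step (∑(c ⊗ d ⊗ s <- lhs R2) pB c ⊗ (pB d ⊗ pA s)).
  by step (∑(r' ⊗ s' <- R) ∑(p ⊗ q <- lhs (pB_mulr_pA s'))
    p ⊗ (pB r' ⊗ q)); sweq.
- unfold projW.
  by step (∑(c ⊗ d ⊗ s <- lhs R2) pB c ⊗ (pB d ⊗ pB s)); sweq.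
- rewrite {1}/projZ.
  step (∑(r ⊗ c ⊗ d <- lhs R3) pA r ⊗ (pA c ⊗ pA d)).
  by step (∑(r' ⊗ s' <- R) ∑(p ⊗ q <- lhs (pA_mull_pA r'))
    p ⊗ (pA s' ⊗ q)); unfold projZ; sweq.
- transitivity (∑(r ⊗ s <- R) ∑(c ⊗ d <- Δ s) pA r ⊗ (pB c ⊗ pA d)).
    unfold projZ, projX.
    step (∑(z ⊗ z' <- R) ∑(p ⊗ q <- lhs (esym (pA_mull_pB z)))
      ∑(c ⊗ d <- tau (pA z' ⊗ q)) p ⊗ (c ⊗ d)).
    step (∑(r ⊗ e ⊗ f <- lhs (esym R3)) ∑(c ⊗ d <- tau (pA e ⊗ pB f))
      pA r ⊗ (c ⊗ d)).
    by step (∑(r ⊗ s <- R) ∑(c ⊗ d <- lhs (tau_pApB s)) pA r ⊗ (c ⊗ d));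
      sweq.
  step (∑(r ⊗ c ⊗ d <- lhs R3) pA r ⊗ (pB c ⊗ pA d)).
  by step (∑(r' ⊗ s' <- R) ∑(p ⊗ q <- lhs (pA_mull_pA r'))
    p ⊗ (pB s' ⊗ q)); unfold projX; sweq.
- unfold projX.
  step (∑(r ⊗ c ⊗ d <- lhs R3) pA r ⊗ (pB c ⊗ pB d)).
  by step (∑(r' ⊗ s' <- R) ∑(p ⊗ q <- lhs (pA_mull_pB r'))
    p ⊗ (pB s' ⊗ q)); sweq.
- unfold projY.
  by step (∑(r ⊗ c ⊗ d <- lhs R3) pB r ⊗ (pA c ⊗ pA d)); sweq.
- unfold projY, projW.
  step (∑(r ⊗ e ⊗ f <- lhs (esym R3)) ∑(c ⊗ d <- tau (pA e ⊗ pB f))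
    pB r ⊗ (c ⊗ d)).
  step (∑(r ⊗ s <- R) ∑(c ⊗ d <- lhs (tau_pApB s)) pB r ⊗ (c ⊗ d)).
  by step (∑(r ⊗ c ⊗ d <- lhs R3) pB r ⊗ (pB c ⊗ pA d)); sweq.
- unfold projW.
  by step (∑(r ⊗ c ⊗ d <- lhs R3) pB r ⊗ (pB c ⊗ pB d)); sweq.
Qed.
End Forward.

(** * Translation of the identities *)

(** Here the action is expanded back into σ and the coaction into τ. *)
Ltac head_rule t ::= lazymatch t with
  | rho ?b => exact (erefl (tau (1 ⊗ b)))
  end.
Ltac leaf_simp ::= rewrite ?(mulZl, mulZr, tensZl, tensZr, scalerA, mulrA, mul1r, mulr1, scale1r).
Ltac leaf_rule pull ::= lazymatch goal with |- ?e = _ => lazymatch e with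
    context [act ?b ?a] => pull (act b a) (actE b a) end end.

(** Products in the arguments of σ and of the action are elaborated through
    different structures of the same ring, equal only up to conversion. *)
Ltac same_tensor t t' ::= unify t t'.

Section Translation.
Variables (W : B ⊗ B) (X : A ⊗ B) (Y : B ⊗ A) (Z : A ⊗ A).

Lemma C1_act a :
  ∑(z1 ⊗ z2 <- Z) ∑(x1' ⊗ x2' <- X) ∑(x1 ⊗ x2 <- X) ∑(w1 ⊗ w2 <- W)
  ∑(y1 ⊗ y2 <- Y) ∑(a1 ⊗ a2 <- cop a) ∑(s ⊗ s' <- sigma (x2' ⊗ y2))
  ∑(t ⊗ t' <- sigma ((w1 * y1) ⊗ a1)) ∑(u ⊗ u' <- sigma ((x2 * w2) ⊗ a2))
    (counit t' *: (z1 * x1' * x1 * t)) ⊗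
    ((counit s' * counit u') *: (z2 * s * u)) =
  ∑(z1 ⊗ z2 <- Z) ∑(x1' ⊗ x2' <- X) ∑(x1 ⊗ x2 <- X) ∑(w1 ⊗ w2 <- W)
  ∑(y1 ⊗ y2 <- Y) ∑(a1 ⊗ a2 <- cop a)
    (z1 * x1' * x1 * ((w1 * y1) ▷ a1)) ⊗
    (z2 * (x2' ▷ y2) * ((x2 * w2) ▷ a2)).
Proof. by sweq. Qed.

Lemma C2_act a :
  ∑(x1 ⊗ x2 <- X) ∑(w1 ⊗ w2 <- W) ∑(s ⊗ s' <- sigma (w1 ⊗ a))
    (counit s' *: (x1 * s)) ⊗ (x2 * w2) =
  ∑(x1 ⊗ x2 <- X) ∑(w1 ⊗ w2 <- W) (x1 * (w1 ▷ a)) ⊗ (x2 * w2).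
Proof. by sweq. Qed.

Lemma C3_act a :
  ∑(w1 ⊗ w2 <- W) ∑(y1 ⊗ y2 <- Y) ∑(s ⊗ s' <- sigma (w2 ⊗ a))
    (w1 * y1) ⊗ (counit s' *: (y2 * s)) =
  ∑(w1 ⊗ w2 <- W) ∑(y1 ⊗ y2 <- Y) (w1 * y1) ⊗ (y2 * (w2 ▷ a)).
Proof. by sweq. Qed.

Lemma C4_act b :
  ∑(z1 ⊗ z2 <- Z) ∑(b1 ⊗ b2 <- cop b) ∑(c ⊗ d <- tau (1 ⊗ b1))
  ∑(s ⊗ s' <- sigma (b2 ⊗ z1)) ∑(t ⊗ t' <- sigma (c ⊗ z2))
    (counit s' *: (d * s)) ⊗ (counit t' *: t) =
  ∑(z1 ⊗ z2 <- Z) ∑(b1 ⊗ b2 <- cop b) ∑(c ⊗ d <- rho b1)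
    (d * (b2 ▷ z1)) ⊗ (c ▷ z2).
Proof. by sweq. Qed.

Lemma C5_act b :
  ∑(x1 ⊗ x2 <- X) ∑(b1 ⊗ b2 <- cop b) ∑(c ⊗ d <- tau (1 ⊗ b1))
  ∑(s ⊗ s' <- sigma (b2 ⊗ x1)) (counit s' *: (d * s)) ⊗ (c * x2) =
  ∑(x1 ⊗ x2 <- X) ∑(b1 ⊗ b2 <- cop b) ∑(c ⊗ d <- rho b1)
    (d * (b2 ▷ x1)) ⊗ (c * x2).
Proof. by sweq. Qed.

Lemma C6_act b :
  ∑(w1 ⊗ w2 <- W) ∑(y1 ⊗ y2 <- Y) ∑(c ⊗ d <- tau (1 ⊗ b))
  ∑(s ⊗ s' <- sigma (w2 ⊗ d)) (w1 * y1 * c) ⊗ (counit s' *: (y2 * s)) =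
  ∑(w1 ⊗ w2 <- W) ∑(y1 ⊗ y2 <- Y) ∑(c ⊗ d <- rho b)
    (w1 * y1 * c) ⊗ (y2 * (w2 ▷ d)).
Proof. by sweq. Qed.

Lemma C8_act :
  ∑(z1 ⊗ z2 <- Z) ∑(x1 ⊗ x2 <- X) ∑(z1' ⊗ z2' <- Z)
  ∑(s ⊗ s' <- sigma (x2 ⊗ z2'))
    (z1 * x1) ⊗ (z1' ⊗ (counit s' *: (z2 * s))) =
  ∑(z1 ⊗ z2 <- Z) ∑(x1 ⊗ x2 <- X) ∑(z1' ⊗ z2' <- Z)
    (z1 * x1) ⊗ (z1' ⊗ (z2 * (x2 ▷ z2'))).
Proof. by sweq. Qed.

Lemma C10_actl :
  ∑(y1 ⊗ y2 <- Y) ∑(z1 ⊗ z2 <- Z) ∑(x1 ⊗ x2 <- X)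
  ∑(c ⊗ d <- tau ((z1 * x1) ⊗ y1)) ∑(s ⊗ s' <- sigma (x2 ⊗ y2))
    c ⊗ (d ⊗ (counit s' *: (z2 * s))) =
  ∑(y1 ⊗ y2 <- Y) ∑(z1 ⊗ z2 <- Z) ∑(x1 ⊗ x2 <- X)
  ∑(c ⊗ d <- tau ((z1 * x1) ⊗ y1)) c ⊗ (d ⊗ (z2 * (x2 ▷ y2))).
Proof. by sweq. Qed.

Lemma C10_actr :
  ∑(w1 ⊗ w2 <- W) ∑(y1 ⊗ y2 <- Y) ∑(z1 ⊗ z2 <- Z)
  ∑(s ⊗ s' <- sigma (w2 ⊗ z2))
    (w1 * y1) ⊗ (z1 ⊗ (counit s' *: (y2 * s))) =
  ∑(w1 ⊗ w2 <- W) ∑(y1 ⊗ y2 <- Y) ∑(z1 ⊗ z2 <- Z)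
    (w1 * y1) ⊗ (z1 ⊗ (y2 * (w2 ▷ z2))).
Proof. by sweq. Qed.

Lemma C12_act :
  ∑(w1 ⊗ w2 <- W) ∑(y1 ⊗ y2 <- Y) ∑(y1' ⊗ y2' <- Y)
  ∑(s ⊗ s' <- sigma (w2 ⊗ y2'))
    (w1 * y1) ⊗ (y1' ⊗ (counit s' *: (y2 * s))) =
  ∑(w1 ⊗ w2 <- W) ∑(y1 ⊗ y2 <- Y) ∑(y1' ⊗ y2' <- Y)
    (w1 * y1) ⊗ (y1' ⊗ (y2 * (w2 ▷ y2'))).
Proof. by sweq. Qed.

Lemma C14_act :
  ∑(z1 ⊗ z2 <- Z) ∑(x1 ⊗ x2 <- X) ∑(z1' ⊗ z2' <- Z) ∑(y1 ⊗ y2 <- Y)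
  ∑(s ⊗ s' <- sigma (y1 ⊗ z1')) ∑(t ⊗ t' <- sigma (x2 ⊗ y2))
    (counit s' *: (z1 * x1 * s)) ⊗ (z2' ⊗ (counit t' *: (z2 * t))) =
  ∑(z1 ⊗ z2 <- Z) ∑(x1 ⊗ x2 <- X) ∑(z1' ⊗ z2' <- Z) ∑(y1 ⊗ y2 <- Y)
    (z1 * x1 * (y1 ▷ z1')) ⊗ (z2' ⊗ (z2 * (x2 ▷ y2))).
Proof. by sweq. Qed.

Lemma C15_act :
  ∑(z1 ⊗ z2 <- Z) ∑(x1 ⊗ x2 <- X) ∑(x1' ⊗ x2' <- X) ∑(y1 ⊗ y2 <- Y)
  ∑(s ⊗ s' <- sigma (y1 ⊗ x1')) ∑(t ⊗ t' <- sigma (x2 ⊗ y2))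
    (counit s' *: (z1 * x1 * s)) ⊗ (x2' ⊗ (counit t' *: (z2 * t))) =
  ∑(z1 ⊗ z2 <- Z) ∑(x1 ⊗ x2 <- X) ∑(x1' ⊗ x2' <- X) ∑(y1 ⊗ y2 <- Y)
    (z1 * x1 * (y1 ▷ x1')) ⊗ (x2' ⊗ (z2 * (x2 ▷ y2))).
Proof. by sweq. Qed.

Lemma alpha_act : alpha sigma W X Y Z = elR W X Y Z.
Proof.
transitivity (∑(z1 ⊗ z2 <- Z) ∑(x1' ⊗ x2' <- X) ∑(x1 ⊗ x2 <- X)
  ∑(w1 ⊗ w2 <- W) ∑(y1 ⊗ y2 <- Y) ∑(s ⊗ s' <- sigma (x2' ⊗ y2))
    ((z1 * x1' * x1) ⊗ (w1 * y1)) ⊗ ((counit s' *: (z2 * s)) ⊗ (x2 * w2))).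
  by [].
by rewrite /elR; sweq.
Qed.

Lemma quasitriangular_dataP :
  quasitriangular_data sigma tau W X Y Z <-> qt_data W X Y Z.
Proof.
split=> [H|D]; split.
- by move=> a; rewrite -C1_act; exact: (C1 H).
- by move=> a; rewrite -C2_act; exact: (C2 H).
- by move=> a; rewrite -C3_act; exact: (C3 H).
- by move=> b; rewrite -C4_act; exact: (C4 H).
- by move=> b; rewrite -C5_act; exact: (C5 H).
- by move=> b; rewrite -C6_act; exact: (C6 H).
- exact: (C7 H).
- by rewrite -C8_act; exact: (C8 H).
- exact: (C9 H).
- by rewrite -C10_actl -C10_actr; exact: (C10 H).
- exact: (C11 H).
- by rewrite -C12_act; exact: (C12 H).
- exact: (C13 H).
- by rewrite -C14_act; exact: (C14 H).
- by rewrite -C15_act; exact: (C15 H).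
- exact: (C16 H).
- exact: (C17 H).
- exact: (C18 H).
- exact: (C19 H).
- by move=> a; move: (D1 D a); rewrite -C1_act.
- by move=> a; move: (D2 D a); rewrite -C2_act.
- by move=> a; move: (D3 D a); rewrite -C3_act.
- by move=> b; move: (D4 D b); rewrite -C4_act.
- by move=> b; move: (D5 D b); rewrite -C5_act.
- by move=> b; move: (D6 D b); rewrite -C6_act.
- exact: (D7 D).
- by move: (D8 D); rewrite -C8_act.
- exact: (D9 D).
- by move: (D10 D); rewrite -C10_actl -C10_actr.
- exact: (D11 D).
- by move: (D12 D); rewrite -C12_act.
- exact: (D13 D).
- by move: (D14 D); rewrite -C14_act.
- by move: (D15 D); rewrite -C15_act.
- exact: (D16 D).
- exact: (D17 D).
- exact: (D18 D).
- exact: (D19 D).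
Qed.
End Translation.

Ltac head_rule t ::= fail.
Ltac leaf_simp ::= base_simp.
Ltac leaf_rule pull ::= fail.

Ltac same_tensor t t' ::= constr_eq t t'.

(** * Products of legs *)

Section Legs.
Variable R : (A ⊗ B) ⊗ (A ⊗ B).
Notation e := (@smash_one _ A B).

Lemma mul3_leg13_leg23 :
  mul3 (smash_mul sigma) (leg13 e R) (leg23 e R) =
  ∑(r ⊗ s <- R) ∑(r' ⊗ s' <- R) r ⊗ (r' ⊗ (s ⋆ s')).
Proof.
transitivity (∑(x ⊗ y <- ∑(r ⊗ s <- R) r ⊗ ((1 ⊗ 1 : A ⊗ B) ⊗ s))
  ∑(x' ⊗ y' <- ∑(r ⊗ s <- R) (1 ⊗ 1 : A ⊗ B) ⊗ (r ⊗ s))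
    (x ⋆ x') ⊗ ∑(c ⊗ d <- y) ∑(c' ⊗ d' <- y') (c ⋆ c') ⊗ (d ⋆ d')).
  by [].
by sweq.
Qed.

Lemma mul3_leg13_leg12 :
  mul3 (smash_mul sigma) (leg13 e R) (leg12 e R) =
  ∑(r ⊗ s <- R) ∑(r' ⊗ s' <- R) (r ⋆ r') ⊗ (s' ⊗ s).
Proof.
transitivity (∑(x ⊗ y <- ∑(r ⊗ s <- R) r ⊗ ((1 ⊗ 1 : A ⊗ B) ⊗ s))
  ∑(x' ⊗ y' <- ∑(r ⊗ s <- R) r ⊗ (s ⊗ (1 ⊗ 1 : A ⊗ B)))
    (x ⋆ x') ⊗ ∑(c ⊗ d <- y) ∑(c' ⊗ d' <- y') (c ⋆ c') ⊗ (d ⋆ d')).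
  by [].
by sweq.
Qed.

Lemma tmul_tswap h :
  tmul (smash_mul sigma) (smash_mul sigma) (tswap (Δ h)) R =
  ∑(r ⊗ s <- R) ∑(c ⊗ d <- Δ h) (d ⋆ r) ⊗ (c ⋆ s).
Proof.
transitivity (∑(x ⊗ y <- ∑(c ⊗ d <- Δ h) d ⊗ c) ∑(r ⊗ s <- R)
  (x ⋆ r) ⊗ (y ⋆ s)); first by [].
by sweq.
Qed.
End Legs.

End SmashBiproduct.

Theorem corollary4p2 (k : fieldType) (A B : algCoalgType k)
    (sigma : {linear (B ⊗ A)%type -> (A ⊗ B)%type})
    (tau : {linear (A ⊗ B)%type -> (B ⊗ A)%type}) :
  smash_biproduct_bialgebra sigma tau ->
  counital_algebra A -> counital_algebra B ->
  unital_coalgebra A -> unital_coalgebra B ->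
  right_conormal sigma -> left_normal tau ->
  ((exists R : (A ⊗ B) ⊗ (A ⊗ B), smash_quasitriangular sigma tau R) <->
   (exists (W : B ⊗ B) (X : A ⊗ B) (Y : B ⊗ A) (Z : A ⊗ A),
      [/\ normalized W, normalized X, normalized Y, normalized Z
        & quasitriangular_data sigma tau W X Y Z])) /\
  (forall R : (A ⊗ B) ⊗ (A ⊗ B),
     smash_quasitriangular sigma tau R <->
     exists (W : B ⊗ B) (X : A ⊗ B) (Y : B ⊗ A) (Z : A ⊗ A),
      [/\ normalized W, normalized X, normalized Y, normalized Z
        & quasitriangular_data sigma tau W X Y Z] /\
      R = alpha sigma W X Y Z).
Proof.
move=> H1 H2 H3 H4 H5 H6 H7.
have S : setting sigma tau by split.
have fwd R : smash_quasitriangular sigma tau R ->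
    exists (W : B ⊗ B) (X : A ⊗ B) (Y : B ⊗ A) (Z : A ⊗ A),
      [/\ normalized W, normalized X, normalized Y, normalized Z
        & quasitriangular_data sigma tau W X Y Z] /\
      R = alpha sigma W X Y Z.
  move=> [q1 q1' q2 q3 q4].
  rewrite (mul3_leg13_leg23 S) in q2; rewrite (mul3_leg13_leg12 S) in q3.
  have q4' h := etrans (q4 h) (tmul_tswap sigma tau R h).
  exists (projW R), (projX R), (projY R), (projZ R); split.
    split.
    - exact: (norm_projW S q1 q1').
    - exact: (norm_projX S q1 q1').
    - exact: (norm_projY S q1 q1').
    - exact: (norm_projZ S q1 q1').
    - by apply/quasitriangular_dataP; exact: (qt_data_R S q2 q3 q4').
  by rewrite alpha_act; exact: (R_eq S q2 q3 q4').
have bwd W X Y Z : normalized W -> normalized X -> normalized Y ->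
    normalized Z -> quasitriangular_data sigma tau W X Y Z ->
    smash_quasitriangular sigma tau (alpha sigma W X Y Z).
  move=> nW nX nY nZ /quasitriangular_dataP D; rewrite alpha_act; split.
  - exact: (qt1l_R S nW nX nY nZ).
  - exact: (qt1r_R S nW nX nY nZ).
  - by rewrite (mul3_leg13_leg23 S); exact: (qt2_R S D).
  - by rewrite (mul3_leg13_leg12 S); exact: (qt3_R S D).
  - by move=> h; rewrite tmul_tswap; exact: (qt4_R S D).
split=> [|R]; split.
- by move=> [R /fwd[W [X [Y [Z [n _]]]]]]; exists W, X, Y, Z.
- move=> [W [X [Y [Z [nW nX nY nZ D]]]]]; exists (alpha sigma W X Y Z).
  exact: bwd.
- exact: fwd.
- by move=> [W [X [Y [Z [[nW nX nY nZ D] ->]]]]]; exact: bwd.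
Qed.
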